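(* Let $\alpha>0$, let $A$ be an $n\times n$ nonsingular $M$-matrix with diagonal entries $a_1,\ldots,a_n$, and let $R=A^{-1}$. Let $X=(X_1,\ldots,X_n)$ be the $\alpha$-permanental random variable determined by $R$ and let $Z=(Z_1,\ldots,Z_n)=Z_{\alpha,\overline B}$ be the associated $\mathbb{N}^n$-valued random variable. Then for all integers $m_j\ge 1$, $j=1,\ldots,n$, $$E\left(\prod_{j=1}^{n}(a_{j}X_{j})^{m_{j}}\right)=E\left(\prod_{j=1}^{n}\prod_{l=0}^{m_{j}-1}(\alpha+Z_{j}+l)\right),$$ or, equivalently, with ${\bf m}=(m_1,\ldots,m_n)$, $$|\overline R({\bf m})|_{\alpha}=E\left(\prod_{j=1}^{n}\prod_{l=0}^{m_{j}-1}(\alpha+Z_{j}+l)\right).$$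
   Context: A real matrix $A=\{a_{i,j}\}_{1\le i,j\le n}$ is a nonsingular $M$-matrix if $a_{i,j}\le 0$ for all $i\ne j$, $A$ is nonsingular, and all entries of $A^{-1}$ are nonnegative. $|M|$ denotes the determinant of a matrix $M$. Let $a_i=a_{i,i}$ be the diagonal entries of $A$ (they are positive), let $D_A=\mathrm{diag}(a_1,\ldots,a_n)$, and write $A=D_A-B$, so $B$ has nonnegative entries and zero diagonal. Set $\overline A=D_A^{-1}A=I-\overline B$ with $\overline B=D_A^{-1}B$, and $\overline R=(\overline A)^{-1}=RD_A$, i.e. $\overline R_{i,j}=R_{i,j}a_j$. The $\alpha$-permanental random variable determined by $R$ is an $\mathbb{R}^n$-valued random variable $X$ (with nonnegative components) with Laplace transform $E(e^{-\sum_{i=1}^n s_iX_i})=|I+RS|^{-\alpha}$ for all $s_i\ge0$, where $S=\mathrm{diag}(s_1,\ldots,s_n)$; it exists for all $\alpha>0$ when $R^{-1}$ is a nonsingular $M$-matrix. For $\alpha>0$ the $\alpha$-permanent of an $n\times n$ matrix $M$ is $|M|_\alpha=\sum_{\pi}\alpha^{c(\pi)}M_{1,\pi(1)}M_{2,\pi(2)}\cdots M_{n,\pi(n)}$, where the sum is over all permutations $\pi$ of $\{1,\ldots,n\}$ and $c(\pi)$ is the number of cycles of $\pi$. $\mathbb{N}=\{0,1,2,\ldots\}$. For ${\bf k}=(k_1,\ldots,k_n)\in\mathbb{N}^n$ put $|{\bf k}|=\sum_l k_l$, and for $1\le m\le|{\bf k}|$ let $i_m=j$ where $j$ is determined by $\sum_{l=1}^{j-1}k_l<m\le\sum_{l=1}^{j}k_l$.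 For an $n\times n$ matrix $C=\{c_{i,j}\}$, $C({\bf k})$ is the $|{\bf k}|\times|{\bf k}|$ matrix with $(p,q)$ entry $c_{i_p,i_q}$; by convention $|C({\bf 0})|_\alpha=1$. $Z=Z_{\alpha,\overline B}$ is an $\mathbb{N}^n$-valued random variable with distribution $P(Z=(k_1,\ldots,k_n))=|\overline A|^{\alpha}\,\dfrac{|\overline B({\bf k})|_\alpha}{\prod_{i=1}^n k_i!}$ (these probabilities sum to 1). *)

(* Defs.v *)
From HB Require Import structures.
From mathcomp Require Export all_boot all_order all_algebra all_fingroup.
From mathcomp Require Export all_classical all_reals all_analysis.

Set Implicit Arguments.
Unset Strict Implicit.
Unset Printing Implicit Defensive.

Import Order.TTheory GRing.Theory Num.Theory.

Local Open Scope classical_set_scope.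
Local Open Scope ring_scope.

Definition nonsingular_M_matrix (R : realType) (n : nat) (A : 'M[R]_n) : Prop :=
  [/\ forall i j, i != j -> A i j <= 0,
      A \in unitmx
    & forall i j, 0 <= invmx A i j].

Definition diag_part (R : realType) (n : nat) (A : 'M[R]_n) : 'M[R]_n :=
  diag_mx (\row_i A i i).

Definition off_part (R : realType) (n : nat) (A : 'M[R]_n) : 'M[R]_n :=
  diag_part A - A.

Definition Abar (R : realType) (n : nat) (A : 'M[R]_n) : 'M[R]_n :=
  invmx (diag_part A) *m A.

Definition Bbar (R : realType) (n : nat) (A : 'M[R]_n) : 'M[R]_n :=
  invmx (diag_part A) *m off_part A.

Definition Rbar (R : realType) (n : nat) (A : 'M[R]_n) : 'M[R]_n :=
  invmx (Abar A).

(* [porbits s] is the set of cycles of [s], fixed points included. *)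
Definition alpha_permanent (R : realType) (alpha : R) (n : nat) (M : 'M[R]_n) : R :=
  \sum_(s : 'S_n) alpha ^+ #|porbits s| * \prod_(i < n) M i (s i).

(* [blowup C k] is C(k): the row (and column) index p : 'I_(\sum_l k_l) is sent
   to the j whose block of length k_j contains p; since p counts from 0, this
   reads \sum_(l < j) k_l <= p < \sum_(l <= j) k_l, see [block_indexP]. *)
Definition block_index (n : nat) (k : n.-tuple nat)
    (p : 'I_(\sum_(l < n) tnth k l)) : 'I_n :=
  tagnat.sig1 p.

Definition blowup (R : realType) (n : nat) (C : 'M[R]_n) (k : n.-tuple nat) :
    'M[R]_(\sum_(l < n) tnth k l) :=
  \matrix_(p, q) C (block_index p) (block_index q).

Lemma block_indexP (n : nat) (k : n.-tuple nat)
    (p : 'I_(\sum_(l < n) tnth k l)) (j : 'I_n) :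
  (block_index p == j) =
  (\sum_(l < n | (l < j)%N) tnth k l <= p < \sum_(l < n | (l <= j)%N) tnth k l)%N.
Proof.
have sumS (i : 'I_n) : (\sum_(l < n | (l <= i)%N) tnth k l =
    \sum_(l < n | (l < i)%N) tnth k l + tnth k i)%N.
  rewrite (bigD1 i) //= addnC; congr addn.
  by apply: eq_bigl => l; rewrite ltn_neqAle andbC.
have mono (P Q : pred 'I_n) : (forall l, P l -> Q l) ->
    (\sum_(l < n | P l) tnth k l <= \sum_(l < n | Q l) tnth k l)%N.
  move=> PQ; rewrite [leqLHS]big_mkcond [leqRHS]big_mkcond /=.
  by apply: leq_sum => l _; case: ifP => // /PQ ->.
have [lo hi] : (\sum_(l < n | (l < block_index p)%N) tnth k l <= p)%N /\
    (p < \sum_(l < n | (l <= block_index p)%N) tnth k l)%N.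
  split.
    by rewrite [leqRHS]tagnat.rect leq_addr.
  by rewrite sumS [ltnLHS]tagnat.rect ltn_add2l.
apply/eqP/andP => [<-//|[lo' hi']]; apply/val_inj.
case: (ltngtP (block_index p) j) => // ltij.
- have := leq_trans hi (leq_trans (mono _ _ (fun l h => leq_ltn_trans h ltij)) lo').
  by rewrite ltnn.
- have := leq_trans hi' (leq_trans (mono _ _ (fun l h => leq_ltn_trans h ltij)) lo).
  by rewrite ltnn.
Qed.

Lemma alpha_permanent_blowup0 (R : realType) (alpha : R) (n : nat) (C : 'M[R]_n) :
  alpha_permanent alpha (blowup C [tuple 0%N | l < n]) = 1.
Proof.
have perm0 N (M : 'M[R]_N) : N = 0%N -> alpha_permanent alpha M = 1.
  move=> N0; subst N; rewrite /alpha_permanent (bigD1 1%g) //= big_ord0 mulr1 big1 => [|s].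
    rewrite addr0 eq_card0 ?expr0 // => B.
    by rewrite inE; apply/imsetP => -[[]].
  by case/eqP; apply/permP => -[].
by apply: perm0; rewrite big1 // => l _; rewrite tnth_mktuple.
Qed.

(* X is an R^n-valued random variable ([n.-tuple R] carries the product
   sigma-algebra). *)
Definition permanental (R : realType) (n : nat) (alpha : R) (K : 'M[R]_n)
    (d : measure_display) (T : measurableType d) (P : probability T R)
    (X : {RV P >-> n.-tuple R}) : Prop :=
  {ae P, forall t, forall j, 0 <= tnth (X t) j} /\
  forall s : 'rV[R]_n, (forall j, 0 <= s 0 j) ->
    'E_P[(fun t => expR (- \sum_(j < n) s 0 j * tnth (X t) j))%R]%E =
    (\det (1%:M + K *m diag_mx s) `^ (- alpha))%:E.

Definition Z_distributed (R : realType) (n : nat) (alpha : R) (A : 'M[R]_n)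
    (d : measure_display) (T : measurableType d) (P : probability T R)
    (Z : {RV P >-> n.-tuple nat}) : Prop :=
  forall k : n.-tuple nat,
    P (Z @^-1` [set k]) =
    (\det (Abar A) `^ alpha *
     (alpha_permanent alpha (blowup (Bbar A) k) /
      (\prod_(i < n) (tnth k i)`!)%:R))%:E.

(* Main.v *)
Require Import Defs.
From mathcomp Require Import ring measurable_realfun.

(** Both sides are mixed derivatives at the origin of the single function
    s |-> |I + Rbar S|^(-alpha), where S = diag(s).

    For a square matrix K and X = diag(x), let C(x) = K (I - X K)^(-1), and for
    a word w in the indices let M(w) be the matrix of the entries
    M_(w_p, w_q).  The functions F_w(x) = |C(x)(w)|_alpha |I - X K|^(-alpha)
    satisfy d/dx_j F_w = F_(j w) ([is_derive_genfun]), so the alpha-permanents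
    |C(x)(w)|_alpha record all the mixed derivatives of |I - X K|^(-alpha).
    Two product rules match here.  Raising x_j perturbs I - X K by a matrix of
    rank one, so C_ab has derivative C_aj C_jb and |I - X K|^(-alpha) has
    logarithmic derivative alpha C_jj.  On the other hand a permutation of the
    word j w either fixes the new letter, which costs a factor alpha M_jj, or
    is obtained by inserting it into an arrow a -> b of a permutation of w,
    which replaces M_ab by M_aj M_jb ([alpha_permanent_insert]).

    Take K = Bbar.  The derivatives at 0 are the |Bbar(k)|_alpha and all the
    F_w are nonnegative near the unit cube, so the Taylor series converges
    (Bernstein, [bernstein_taylor]) and the law of Z has the generating
    function E prod_i x_i^(Z_i) = (|Abar| / |I - X Bbar|)^alpha
    ([transform_of_law]).

    Take K = - Rbar.  If the random functions phi_j(m, s) >= 0 satisfy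
    d/ds phi_j(m, s) = - phi_j(m + 1, s) and
    E prod_j phi_j(0, s_j) = |I + S Rbar|^(-alpha) for s >= 0, then
    E prod_j phi_j(m_j, 0) = |Rbar(m)|_alpha ([moment_word_permanent]).
    The functions (a_j X_j)^m exp(- s a_j X_j) qualify by the definition of a
    permanental variable.  So do
    (alpha + Z_j) ... (alpha + Z_j + m - 1) (1 + s)^(- alpha - Z_j - m): their
    transform is the generating function of Z at x_j = 1 / (1 + s_j), because
    (I + S)(I - X Bbar) = Abar + S = (I + S Rbar) Abar.  At s = 0 these two
    families give the two moments of the statement. *)

Set Implicit Arguments.
Unset Strict Implicit.
Unset Printing Implicit Defensive.

Import Order.TTheory GRing.Theory Num.Theory.
Import numFieldNormedType.Exports.

Local Open Scope ring_scope.

(** * Inserting a point into a permutation *)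

Lemma lift_perm0_expg (N : nat) (s : 'S_N) (k : nat) (i : 'I_N) :
  ((lift_perm ord0 ord0 s ^+ k)%g : 'S_N.+1) (lift ord0 i) =
  lift ord0 ((s ^+ k)%g i).
Proof.
elim: k => [|k IH]; first by rewrite !expg0 !perm1.
by rewrite !expgSr !permM IH lift_perm_lift.
Qed.

Lemma card_porbits_lift_perm0 (N : nat) (s : 'S_N) :
  #|porbits (lift_perm ord0 ord0 s : 'S_N.+1)| = #|porbits s|.+1.
Proof.
set t := lift_perm ord0 ord0 s.
pose L (B : {set 'I_N}) : {set 'I_N.+1} := lift ord0 @: B.
have porbit_lift i : porbit t (lift ord0 i) = L (porbit s i).
  apply/setP => x; apply/porbitP/imsetP => [[k ->]|[y /porbitP[k ->] ->]].
    by exists ((s ^+ k)%g i); rewrite ?mem_porbit // lift_perm0_expg.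
  by exists k; rewrite lift_perm0_expg.
have porbit_0 : porbit t ord0 = [set ord0].
  apply/setP => x; rewrite inE; apply/porbitP/eqP => [[k ->]|->]; last first.
    by exists 0%N; rewrite expg0 perm1.
  elim: k => [|k IH]; first by rewrite expg0 perm1.
  by rewrite expgSr permM IH lift_perm_id.
have -> : porbits t = [set ord0] |: (L @: porbits s).
  apply/setP => B; rewrite !inE; apply/imsetP/orP => [[x _ ->]|].
    case: (unliftP ord0 x) => [y|] ->; last by left; rewrite porbit_0.
    by right; rewrite porbit_lift imset_f // imset_f.
  case=> [/eqP ->|/imsetP[_ /imsetP[i _ ->] ->]]; first by exists ord0.
  by exists (lift ord0 i).
rewrite cardsU1 card_imset; last exact/imset_inj/lift_inj.
suff -> : [set ord0] \notin L @: porbits s by [].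
apply/imsetP => -[B _ /setP/(_ ord0)]; rewrite inE eqxx => /esym/imsetP[i _].
by move/eqP; rewrite (negbTE (neq_lift _ _)).
Qed.

(** The permutations fixing [ord0] are exactly the lifts of the permutations of
    the remaining points. *)
Lemma sum_perm_lift (V : nmodType) (N : nat) (f : 'S_N.+1 -> V) :
  \sum_(t : 'S_N.+1 | t ord0 == ord0) f t =
  \sum_(s : 'S_N) f (lift_perm ord0 ord0 s).
Proof.
rewrite (reindex (@lift_perm N ord0 ord0)); last first.
  pose ulsf i (s : 'S_N.+1) k := odflt k (unlift (s i) (s (lift i k))).
  have ulsfK i (s : 'S_N.+1) k : lift (s i) (ulsf i s k) = s (lift i k).
    rewrite /ulsf; have := neq_lift i k.
    by rewrite -(can_eq (permK s)) => /unlift_some[] ? ? ->.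
  have inj_ulsf : injective (ulsf ord0 _).
    move=> s; apply: can_inj (ulsf (s ord0) s^-1%g) _ => k'.
    by rewrite {1}/ulsf ulsfK !permK liftK.
  exists (fun s => perm (inj_ulsf s)) => [s _ | s].
    by apply/permP=> k'; rewrite permE /ulsf lift_perm_lift lift_perm_id liftK.
  move/(s _ =P _) => si0; apply/permP=> k.
  case: (unliftP ord0 k) => [k'|] ->; rewrite ?lift_perm_id //.
  by rewrite lift_perm_lift -[X in lift X _]si0 permE ulsfK.
by apply: eq_bigl => s; rewrite lift_perm_id eqxx.
Qed.

(** Every permutation of [0, N] is [tperm ord0 p] followed by a permutation
    fixing [ord0], where [p] is the preimage of [ord0].  For [p = ord0] the
    point 0 is a cycle of its own; otherwise it is inserted just after [p] in
    an existing cycle, and the number of cycles does not change. *)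
Lemma alpha_permanent_insert (R : realType) (alpha : R) (N : nat)
    (M : 'M[R]_N.+1) :
  alpha_permanent alpha M =
  alpha * M ord0 ord0 * alpha_permanent alpha (\matrix_(p, q) M (lift ord0 p) (lift ord0 q)) +
  \sum_(s : 'S_N) alpha ^+ #|porbits s| *
    \sum_p (M (lift ord0 p) ord0 * M ord0 (lift ord0 (s p))) *
       \prod_(q | q != p) M (lift ord0 q) (lift ord0 (s q)).
Proof.
rewrite {1}/alpha_permanent.
rewrite (partition_big (fun t : 'S_N.+1 => (t^-1)%g ord0) predT) //=.
have fiber p (f : 'S_N.+1 -> R) : \sum_(t : 'S_N.+1 | (t^-1)%g ord0 == p) f t =
    \sum_(s : 'S_N) f (tperm ord0 p * lift_perm ord0 ord0 s)%g.
  rewrite (reindex_inj (mulgI (tperm ord0 p))) /= -(sum_perm_lift (fun u => f (tperm ord0 p * u)%g)).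
  apply: eq_bigl => t; rewrite -(inj_eq (@perm_inj _ (tperm ord0 p * t)%g)) permKV.
  by rewrite permM tpermR eq_sym.
under eq_bigr do rewrite fiber.
rewrite big_ord_recl; congr (_ + _).
  rewrite /alpha_permanent big_distrr /=; apply: eq_bigr => s _.
  rewrite tperm1 mul1g card_porbits_lift_perm0 exprS big_ord_recl lift_perm_id.
  rewrite (eq_bigr (fun q => M (lift ord0 q) (lift ord0 (s q)))); last first.
    by move=> q _; rewrite lift_perm_lift.
  under [in RHS]eq_bigr do rewrite mxE.
  by rewrite mulrACA.
rewrite exchange_big; apply: eq_bigr => s _; rewrite mulr_sumr.
apply: eq_bigr => p _.
set t := lift_perm ord0 ord0 s.
have -> : #|porbits (tperm ord0 (lift ord0 p) * t)%g| = #|porbits s|.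
  have := porbits_mul_tperm t ord0 (lift ord0 p).
  rewrite (neq_lift ord0 p) card_porbits_lift_perm0 /=.
  suff -> : ord0 \notin porbit t (lift ord0 p).
    by rewrite !addn1 addn2 => -[].
  apply/porbitP => -[k]; rewrite lift_perm0_expg => /eqP.
  by rewrite (negbTE (neq_lift _ _)).
congr (_ * _); rewrite big_ord_recl permM tpermL lift_perm_lift.
rewrite (bigD1 p) //= permM tpermR lift_perm_id mulrA; congr (_ * _).
  by rewrite mulrC.
apply: eq_bigr => q qp; rewrite permM tpermD ?neq_lift ?lift_perm_lift //.
by rewrite (inj_eq lift_inj) eq_sym.
Qed.

(** * Alpha-permanents of words *)

(** Indexing by arbitrary words, and not only by the sorted words of a
    multi-index, lets a letter be added in front without reordering. *)
Definition word_permanent (R : realType) (alpha : R) (n : nat) (M : 'M[R]_n)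
    (w : seq 'I_n) : R :=
  alpha_permanent alpha (\matrix_(p, q) M (tnth (in_tuple w) p) (tnth (in_tuple w) q)).

Lemma word_permanent_nil (R : realType) (alpha : R) (n : nat) (M : 'M[R]_n) :
  word_permanent alpha M [::] = 1.
Proof.
rewrite /word_permanent /alpha_permanent (bigD1 1%g) //= big_ord0 mulr1.
rewrite big1 ?addr0 => [|s /eqP []]; last by apply/permP => -[].
by rewrite eq_card0 ?expr0 // => B; rewrite inE; apply/imsetP => -[[]].
Qed.

Lemma word_permanent_cons (R : realType) (alpha : R) (n : nat) (M : 'M[R]_n)
    (j : 'I_n) (w : seq 'I_n) :
  let i p := tnth (in_tuple w) p in
  word_permanent alpha M (j :: w) =
  alpha * M j j * word_permanent alpha M w +
  \sum_(s : 'S_(size w)) alpha ^+ #|porbits s| *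
    \sum_p (M (i p) j * M j (i (s p))) *
       \prod_(q | q != p) M (i q) (i (s q)).
Proof.
have lift_tnth p : tnth (in_tuple (j :: w)) (lift ord0 p) = tnth (in_tuple w) p.
  by rewrite !(tnth_nth j).
have tnth_head : tnth (in_tuple (j :: w)) ord0 = j by rewrite (tnth_nth j).
rewrite /word_permanent alpha_permanent_insert !mxE tnth_head.
congr (_ * alpha_permanent _ _ + _).
  by apply/matrixP => p q; rewrite !mxE !lift_tnth.
apply: eq_bigr => s _; congr (_ * _); apply: eq_bigr => p _.
rewrite !mxE tnth_head !lift_tnth; congr (_ * _).
by apply: eq_bigr => q _; rewrite !mxE !lift_tnth.
Qed.

Lemma word_permanentN (R : realType) (alpha : R) (n : nat) (M : 'M[R]_n)
    (w : seq 'I_n) :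
  word_permanent alpha (- M) w = (-1) ^+ size w * word_permanent alpha M w.
Proof.
rewrite /word_permanent /alpha_permanent mulr_sumr; apply: eq_bigr => s _.
rewrite mulrCA; congr (_ * _).
under eq_bigr do rewrite !mxE -mulN1r.
rewrite big_split /= prodr_const card_ord; congr (_ * _).
by apply: eq_bigr => p _; rewrite mxE.
Qed.

Lemma word_permanent_ge0 (R : realType) (alpha : R) (n : nat) (M : 'M[R]_n)
    (w : seq 'I_n) :
  0 <= alpha -> (forall i j, 0 <= M i j) -> 0 <= word_permanent alpha M w.
Proof.
move=> a0 M0; apply: sumr_ge0 => s _; apply: mulr_ge0; first exact: exprn_ge0.
by apply: prodr_ge0 => p _; rewrite mxE.
Qed.

Definition block_word (n : nat) (k : 'I_n -> nat) (r : seq 'I_n) : seq 'I_n :=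
  flatten [seq nseq (k i) i | i <- r].

Lemma count_block_word (n : nat) (k : 'I_n -> nat) (j : 'I_n) (r : seq 'I_n) :
  count_mem j (block_word k r) = (k j * count_mem j r)%N.
Proof.
elim: r => [|i r IH]; first by rewrite muln0.
rewrite /block_word /= count_cat -/(block_word k r) IH count_nseq /= mulnDr.
by congr addn; have [->|_] := eqVneq i j; rewrite ?muln0 ?mul0n // mul1n muln1.
Qed.

(** The size of [w] is only propositionally equal to [N], hence the detour
    through an indexing function [f]. *)
Lemma word_permanent_reindex (R : realType) (alpha : R) (n N : nat) (M : 'M[R]_n)
    (w : seq 'I_n) (f : 'I_N -> 'I_n) :
  size w = N -> (forall (p : 'I_N) i0, nth i0 w p = f p) ->
  alpha_permanent alpha (\matrix_(p, q) M (f p) (f q)) = word_permanent alpha M w.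
Proof.
move=> Nw; case: N / Nw f => f fw; congr alpha_permanent.
by apply/matrixP => p q; rewrite !mxE !(tnth_nth (f p)) !fw.
Qed.

Lemma alpha_permanent_blowup (R : realType) (alpha : R) (n : nat) (C : 'M[R]_n)
    (k : n.-tuple nat) :
  alpha_permanent alpha (blowup C k) =
  word_permanent alpha C (block_word (tnth k) (enum 'I_n)).
Proof.
apply: word_permanent_reindex => [|p i0].
  rewrite size_flatten /shape -map_comp sumnE big_map big_enum /=.
  by apply: eq_bigr => i _; rewrite size_nseq.
rewrite /block_index; set i := tagnat.sig1 p.
have nth_k (j : 'I_n) : nth 0%N [seq tnth k i | i <- enum 'I_n] j = tnth k j.
  by rewrite (nth_map i) ?size_enum_ord // nth_ord_enum.
have pE : val p = flatten_index [seq tnth k i | i <- enum 'I_n] i (tagnat.sig2 p).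
  rewrite [LHS]tagnat.rect /flatten_index; congr addn.
  rewrite sumnE (big_nth 0%N) size_takel; last by rewrite size_map size_enum_ord ltnW.
  rewrite big_mkord [RHS](eq_bigr (fun j : 'I_i => nth 0%N [seq tnth k i | i <- enum 'I_n] j)); last first.
    by move=> j _; rewrite nth_take.
  rewrite (eq_bigr (fun j : 'I_n => nth 0%N [seq tnth k i | i <- enum 'I_n] j)).
    exact: big_ord_narrow (ltnW (ltn_ord i)).
  by move=> j _; rewrite nth_k.
rewrite /block_word nth_flatten.
have -> : shape [seq nseq (tnth k i) i | i <- enum 'I_n] =
          [seq tnth k i | i <- enum 'I_n].
  by rewrite /shape -map_comp; apply: eq_map => j /=; rewrite size_nseq.
rewrite pE flatten_indexKl ?flatten_indexKr ?nth_k //.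
by rewrite (nth_map i) ?size_enum_ord // nth_ord_enum nth_nseq ltn_ord.
Qed.

(** * Rank-one updates of the resolvent *)

(** The two sides are the determinants of the two triangular factorizations of
    the block matrix with diagonal blocks 1, 1 and off-diagonal blocks u, v. *)
Lemma det_1B_rank1 (F : comNzRingType) (n : nat) (u : 'cV[F]_n) (v : 'rV[F]_n) :
  \det (1%:M - u *m v) = 1 - (v *m u) 0 0.
Proof.
have eqB : block_mx (1%:M - u *m v) u 0 (1%:M : 'M[F]_1) *m block_mx 1%:M 0 v 1%:M =
           block_mx 1%:M 0 v 1%:M *m block_mx 1%:M u 0 (1%:M - v *m u).
  rewrite !mulmx_block !mul1mx !mulmx1 !mul0mx !mulmx0 !addr0 !add0r subrK.
  by rewrite addrC subrK.
have := congr1 determinant eqB.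
rewrite !det_mulmx !det_ublock !det_lblock !det1 !mul1r !mulr1 => ->.
by rewrite [X in \det X]mx11_scalar det_scalar1 !mxE.
Qed.

Lemma mulmx_delta_mulmx (F : comNzRingType) (n : nat) (C : 'M[F]_n) (j c d : 'I_n) :
  (C *m delta_mx j j *m C) c d = C c j * C j d.
Proof.
have CE i : (C *m delta_mx j j) c i = C c j *+ (i == j).
  rewrite mxE (bigD1 j) //= big1 ?addr0 => [|k kj].
    by rewrite mxE eqxx mulr_natr.
  by rewrite mxE (negbTE kj) mulr0.
rewrite mxE (bigD1 j) //= big1 ?addr0 => [|i ij]; first by rewrite CE eqxx.
by rewrite CE (negbTE ij) mul0r.
Qed.

Lemma delta_mulmx_delta (F : comNzRingType) (n : nat) (C : 'M[F]_n) (j : 'I_n) :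
  delta_mx j j *m C *m delta_mx j j = C j j *: delta_mx j j.
Proof.
apply/matrixP => c d; rewrite mxE (bigD1 j) //= big1 ?addr0 => [|i ij].
  have -> : (delta_mx j j *m C) c j = C j j *+ (c == j).
    rewrite mxE (bigD1 j) //= big1 ?addr0 => [|k kj].
      by rewrite mxE eqxx andbT mulr_natl.
    by rewrite mxE (negbTE kj) andbF mul0r.
  by rewrite !mxE !eqxx /=; case: (c == j); rewrite ?mul0r ?mulr0.
by rewrite [X in _ * X]mxE (negbTE ij) mulr0.
Qed.

(** The Sherman-Morrison formula in division-free form: with
    [g = h / (1 - h * C j j)] the hypothesis on [g] holds. *)
Lemma mulmx_rank1_update (F : comNzRingType) (n : nat) (C : 'M[F]_n) (j : 'I_n)
    (g h : F) :
  g - (h + h * g * C j j) = 0 ->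
  (C + g *: (C *m delta_mx j j *m C)) *m (1%:M - h *: (delta_mx j j *m C)) = C.
Proof.
move=> gh; set E := delta_mx j j.
have CECEC : C *m E *m C *m (E *m C) = C j j *: (C *m E *m C).
  rewrite mulmxA -(mulmxA C E C) -(mulmxA C (E *m C) E) delta_mulmx_delta.
  by rewrite -scalemxAr -scalemxAl (mulmxA C E C).
rewrite mulmxBr mulmx1 mulmxDl -!scalemxAr -!scalemxAl CECEC mulmxA.
by rewrite !scalerA -scalerDl -addrA -scalerBl gh scale0r addr0.
Qed.

Definition defect (R : realType) (n : nat) (K : 'M[R]_n) (x : 'rV[R]_n) : 'M[R]_n :=
  1%:M - diag_mx x *m K.

Definition resolvent (R : realType) (n : nat) (K : 'M[R]_n) (x : 'rV[R]_n) : 'M[R]_n :=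
  K *m invmx (defect K x).

(** |I - X K|^(-alpha) and, by [is_derive_genfun], its mixed derivatives: one
    differentiation for each letter of [w]. *)
Definition genfun (R : realType) (alpha : R) (n : nat) (K : 'M[R]_n)
    (w : seq 'I_n) (x : 'rV[R]_n) : R :=
  word_permanent alpha (resolvent K x) w * (\det (defect K x)) `^ (- alpha).

Section RankOneUpdate.
Variables (R : realType) (n : nat) (K : 'M[R]_n) (x : 'rV[R]_n) (j : 'I_n) (h : R).
Hypothesis D_neq0 : \det (defect K x) != 0.

Let C := resolvent K x.
Let E : 'M[R]_n := delta_mx j j.

Let N_unit : defect K x \in unitmx.
Proof. by rewrite unitmxE unitfE. Qed.

Lemma defect_update :
  defect K (x + h *: delta_mx 0 j) = (1%:M - h *: (E *m C)) *m defect K x.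
Proof.
rewrite mulmxBl mul1mx -scalemxAl -mulmxA mulmxKV //.
rewrite {1}/defect linearD linearZ /= mulmxDl opprD addrA -scalemxAl.
congr (_ - h *: (_ *m _)); apply/matrixP => a b; rewrite !mxE eqxx /=.
by rewrite -mulnb natrM; have [->|_] := eqVneq a j; rewrite ?mul1r ?mul0r ?mul0rn // eq_sym.
Qed.

Lemma det_defect_update :
  \det (defect K (x + h *: delta_mx 0 j)) = \det (defect K x) * (1 - h * C j j).
Proof.
rewrite defect_update det_mulmx mulrC; congr (_ * _).
have -> : h *: (E *m C) = (h *: delta_mx j 0 : 'cV_n) *m row j C.
  by rewrite -scalemxAl rowE mulmxA mul_delta_mx.
by rewrite det_1B_rank1 -scalemxAr -colE !mxE.
Qed.

Lemma resolvent_update : 1 - h * C j j != 0 ->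
  forall a b, resolvent K (x + h *: delta_mx 0 j) a b =
    C a b + h / (1 - h * C j j) * (C a j * C j b).
Proof.
move=> c_neq0 a b; set g := h / _.
suff -> : resolvent K (x + h *: delta_mx 0 j) = C + g *: (C *m E *m C).
  by rewrite mxE [X in _ + X]mxE mulmx_delta_mulmx.
have unit' : defect K (x + h *: delta_mx 0 j) \in unitmx.
  by rewrite unitmxE unitfE det_defect_update mulf_neq0.
rewrite /resolvent; apply: (can_inj (mulmxK unit')).
rewrite mulmxKV // defect_update mulmxA.
rewrite mulmx_rank1_update ?/C /resolvent ?mulmxKV //.
by rewrite -/(resolvent K x) -/C /g; field.
Qed.

End RankOneUpdate.

Local Open Scope classical_set_scope.

(** * Mixed derivatives of a power of the determinant *)

Lemma is_derive_big_sum (R : realType) (I : Type) (r : seq I) (h : I -> R -> R)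
    (dh : I -> R) (t : R) :
  (forall i, is_derive t 1 (h i) (dh i)) ->
  is_derive t 1 (fun u => \sum_(i <- r) h i u) (\sum_(i <- r) dh i).
Proof.
move=> hh; have -> : (fun u => \sum_(i <- r) h i u) = \sum_(i <- r) h i.
  by apply/funext => u; rewrite fct_sumE.
elim: r => [|i r IH]; first by rewrite !big_nil; exact: is_derive_cst.
by rewrite !big_cons; exact: is_deriveD.
Qed.

Lemma is_derive_big_prod (R : realType) (N : nat) (f : 'I_N -> R -> R)
    (df : 'I_N -> R) (t : R) :
  (forall p, is_derive t 1 (f p) (df p)) ->
  is_derive t 1 (fun u => \prod_p f p u)
    (\sum_p df p * \prod_(q | q != p) f q t).
Proof.
elim: N f df => [|N IH] f df hf.
  rewrite big_ord0 (_ : (fun _ => _) = cst 1); first exact: is_derive_cst.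
  by apply/funext => u; rewrite big_ord0.
have -> : (fun u => \prod_p f p u) =
    f ord0 * (fun u => \prod_(p < N) f (lift ord0 p) u).
  by apply/funext => u; rewrite big_ord_recl.
have IHf := @IH (fun p => f (lift ord0 p)) (fun p => df (lift ord0 p)) (fun p => hf _).
apply: (is_derive_eq (is_deriveM (hf ord0) IHf)).
rewrite big_ord_recl addrC; congr (_ + _).
  rewrite [LHS]mulrC; congr (_ * _).
  by rewrite [RHS]big_mkcond big_ord_recl eqxx /= mul1r; apply: eq_bigr => p _.
rewrite [LHS]mulr_sumr; apply: eq_bigr => p _.
rewrite mulrCA; congr (_ * _).
rewrite [RHS]big_mkcond big_ord_recl /= [in LHS]big_mkcond; congr (_ * _).
Qed.

(** Near [t] the rank-one update makes every entry of the resolvent and the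
    determinant explicit rational functions of [u - t]; the product rule for
    the permanent then produces exactly the terms of [word_permanent_cons]. *)
Lemma is_derive_genfun (R : realType) (alpha : R) (n : nat) (K : 'M[R]_n)
    (w : seq 'I_n) (x : 'rV[R]_n) (j : 'I_n) (t : R) :
  0 < \det (defect K (x + t *: delta_mx 0 j)) ->
  is_derive t 1 (fun u : R => genfun alpha K w (x + u *: delta_mx 0 j))
    (genfun alpha K (j :: w) (x + t *: delta_mx 0 j)).
Proof.
set y := x + _ => D_gt0.
pose C := resolvent K y; pose c := C j j; pose D := \det (defect K y).
pose i p := tnth (in_tuple w) p.
pose e a b (u : R) := C a b + (u - t) / (1 - (u - t) * c) * (C a j * C j b).
have lin_der : is_derive t 1 (fun u : R => 1 - (u - t) * c) (- c).
  have -> : (fun u : R => 1 - (u - t) * c) = cst 1 - c \*: (shift (- t) : R -> R).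
    by apply/funext => u; rewrite !fctE /= mulrC.
  apply: (is_derive_eq (is_deriveB (is_derive_cst _ _ _) (is_deriveZ c (is_derive_shift _ _ _)))).
  by rewrite sub0r; congr (- _); exact: mulr1.
have lin_t : 1 - (t - t) * c = 1 by rewrite subrr mul0r subr0.
have e_der a b : is_derive t 1 (e a b) (C a j * C j b).
  have lin_t0 : 1 - (t - t) * c != 0 by rewrite lin_t oner_neq0.
  have -> : e a b = cst (C a b) + (C a j * C j b) \*:
      ((shift (- t) : R -> R) * (fun u => (1 - (u - t) * c)^-1)).
    by apply/funext => u; rewrite !fctE /e /= mulrC.
  have inv_der := @is_deriveV _ (fun u => 1 - (u - t) * c) t _ _ lin_t0 lin_der.
  have quo_der := is_deriveM (is_derive_shift t 1 (- t)) inv_der.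
  have Z_der := is_deriveZ (C a j * C j b) quo_der.
  have D_der := is_deriveD (is_derive_cst (C a b) t 1) Z_der.
  apply: (is_derive_eq D_der).
  rewrite add0r /= lin_t subrr scale0r add0r invr1 scale1r.
  exact: mulr1.
have pow_der : is_derive t 1 (fun u : R => (D * (1 - (u - t) * c)) `^ (- alpha))
    (alpha * c * D `^ (- alpha)).
  have D_t : 0 < D * (1 - (t - t) * c) by rewrite lin_t mulr1.
  have base_der : is_derive t 1 (fun u : R => D * (1 - (u - t) * c)) (D * - c).
    exact: is_deriveZ.
  apply: (is_derive_eq (@is_derive1_comp _ ((@powR R)^~ (- alpha)) _ t _ _
    (is_derive1_powR (- alpha) D_t) base_der)).
  rewrite lin_t mulr1.
  have -> : D `^ (- alpha) = D `^ (- alpha - 1) * D.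
    by rewrite -[X in _ * X](@powRr1 _ D) ?ltW // -powRD ?subrK // (gt_eqF D_gt0) implybT.
  by move: (D `^ _) => z; ring.
pose per (u : R) := \sum_(s : 'S_(size w)) alpha ^+ #|porbits s| * \prod_p e (i p) (i (s p)) u.
have et a b : e a b t = C a b by rewrite /e subrr !mul0r addr0.
have per_der : is_derive t 1 per (\sum_(s : 'S_(size w)) alpha ^+ #|porbits s| *
    \sum_p (C (i p) j * C j (i (s p))) * \prod_(q | q != p) C (i q) (i (s q))).
  apply: is_derive_big_sum => s; apply: is_deriveZ.
  under [X in is_derive _ _ _ X]eq_bigr do under eq_bigr do rewrite -et.
  exact: (is_derive_big_prod (fun p => e_der _ _)).
apply: (@near_eq_is_derive _ _ _ (per * (fun u : R => (D * (1 - (u - t) * c)) `^ (- alpha)))).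
  have lin_cont : {for t, continuous (fun u : R => 1 - (u - t) * c)}.
    exact/differentiable_continuous/derivable1_diffP/ex_derive.
  have lin_gt0 : \forall u \near t, 0 < 1 - (u - t) * c.
    have := @cvgr_gt R R (nbhs t) _ _ _ lin_cont 0.
    by rewrite lin_t; apply; exact: ltr01.
  near=> u; have l0 : 0 < 1 - (u - t) * c by near: u.
  have -> : x + u *: delta_mx 0 j = y + (u - t) *: delta_mx 0 j.
    by rewrite /y -addrA -scalerDl (addrC t) subrK.
  rewrite /genfun det_defect_update ?gt_eqF // -/C -/c -/D fctE; congr (_ * _).
  apply: eq_bigr => s _; congr (_ * _); apply: eq_bigr => p _.
  by rewrite mxE resolvent_update ?gt_eqF.
apply: (is_derive_eq (is_deriveM per_der pow_der)).
(* the fixed point [j] comes from the determinant, the insertions from the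
   entries *)
rewrite /genfun -/C -/D word_permanent_cons -/i -/c lin_t mulr1.
have -> : per t = word_permanent alpha C w.
  apply: eq_bigr => s _; congr (_ * _); apply: eq_bigr => p _.
  by rewrite mxE et.
rewrite /GRing.scale /=; set S := \sum_s _.
move: (word_permanent _ _ _) (D `^ _) => W z; ring.
Unshelve. all: by end_near. Qed.

(** * Z-matrices *)

Section ZMatrix.
Variables (R : realType) (n : nat).
Implicit Types (M : 'M[R]_n) (v y : 'cV[R]_n).

(** Minimum principle.  At an index where [y / v] attains its minimum [c], all
    the off-diagonal terms of [M *m (y - c *: v)] are nonpositive and the
    diagonal one vanishes, which excludes [c < 0]. *)
Lemma Z_matrix_monotone M v y : (forall i j, i != j -> M i j <= 0) ->
  (forall i, 0 < v i 0) -> (forall i, 0 < (M *m v) i 0) ->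
  (forall i, 0 <= (M *m y) i 0) -> forall i, 0 <= y i 0.
Proof.
move=> Z_M v_gt0 Mv_gt0 My_ge0 i.
case: (@arg_minP _ _ _ i predT (fun k => y k 0 / v k 0)) => // m _ m_min.
pose c := y m 0 / v m 0.
have y_ge k : c * v k 0 <= y k 0 by rewrite -ler_pdivlMr // m_min.
suff c_ge0 : 0 <= c by apply: le_trans (y_ge i); rewrite mulr_ge0 // ltW.
rewrite leNgt; apply/negP => c_lt0.
have : 0 < (M *m (y - c *: v)) m 0.
  rewrite mulmxBr -scalemxAr mxE [X in _ + X]mxE [X in _ - X]mxE.
  by rewrite ltr_pwDr // oppr_gt0 nmulr_rlt0.
apply/negP; rewrite -leNgt mxE; apply: sumr_le0 => k _; rewrite !mxE.
have [->|km] := eqVneq k m; first by rewrite divfK ?subrr ?mulr0 // gt_eqF.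
by rewrite mulr_le0_ge0 // ?subr_ge0 ?y_ge // Z_M // eq_sym.
Qed.

Lemma Z_matrix_unit M v : (forall i j, i != j -> M i j <= 0) ->
  (forall i, 0 < v i 0) -> (forall i, 0 < (M *m v) i 0) -> M \in unitmx.
Proof.
move=> Z_M v_gt0 Mv_gt0; rewrite -unitmx_tr -row_free_unit.
apply: inj_row_free => u uM0.
have Mu0 : M *m u^T = 0 by apply: trmx_inj; rewrite trmx_mul trmxK uM0 trmx0.
apply/rowP => i; rewrite mxE; apply/eqP; rewrite eq_le -oppr_ge0; apply/andP; split.
  have := @Z_matrix_monotone M v (- u^T) Z_M v_gt0 Mv_gt0.
  by rewrite mulmxN Mu0 => /(_ _ i); rewrite !mxE; apply=> k; rewrite !mxE oppr0.
have := @Z_matrix_monotone M v u^T Z_M v_gt0 Mv_gt0.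
by rewrite Mu0 => /(_ _ i); rewrite !mxE; apply=> k; rewrite !mxE.
Qed.

Lemma Z_matrix_inv_ge0 M v : (forall i j, i != j -> M i j <= 0) ->
  (forall i, 0 < v i 0) -> (forall i, 0 < (M *m v) i 0) ->
  forall i j, 0 <= invmx M i j.
Proof.
move=> Z_M v_gt0 Mv_gt0 i j.
have := @Z_matrix_monotone M v (col j (invmx M)) Z_M v_gt0 Mv_gt0.
rewrite colE mulmxA mulmxV ?(Z_matrix_unit Z_M v_gt0) // mul1mx -colE.
move=> /(_ _ i); rewrite mxE; apply=> k; rewrite mxE; exact: ler0n.
Qed.

(** The segment from [M] to the identity consists of Z-matrices that are
    positive on [v], hence invertible, so the determinant keeps its sign. *)
Lemma Z_matrix_det_gt0 M v : (forall i j, i != j -> M i j <= 0) ->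
  (forall i, 0 < v i 0) -> (forall i, 0 < (M *m v) i 0) -> 0 < \det M.
Proof.
move=> Z_M v_gt0 Mv_gt0; rewrite ltNge; apply/negP => det_le0.
pose N : 'M[{poly R}]_n := map_mx polyC M + 'X *: map_mx polyC (1%:M - M).
have N_eval t : (\det N).[t] = \det (M + t *: (1%:M - M)).
  rewrite -[LHS]/(horner_eval t (\det N)) -det_map_mx; congr determinant.
  apply/matrixP => a b; rewrite !mxE /horner_eval. by rewrite -[LHS]/((_ + _).[t]) !hornerE.
have [t] : exists2 t, 0 <= t <= 1 & root (\det N) t.
  apply: poly_ivt; first exact: ler01.
  by rewrite !N_eval scale0r addr0 det_le0 scale1r addrC subrK det1 ler01.
move=> /andP[t0 t1]; rewrite rootE N_eval; apply/negP.
rewrite -unitfE -unitmxE; apply: (@Z_matrix_unit _ v) => // [a b ab|a].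
  rewrite !mxE (negbTE ab) sub0r mulrN -[X in X - _]mul1r -mulrBl.
  by rewrite mulr_ge0_le0 ?subr_ge0 ?Z_M.
have -> : ((M + t *: (1%:M - M)) *m v) a 0 = (1 - t) * (M *m v) a 0 + t * v a 0.
  rewrite mulmxDl -scalemxAl mulmxBl mul1mx; move: (M *m v) => u.
  by rewrite !mxE; ring.
have [->|t_neq0] := eqVneq t 0; first by rewrite subr0 mul1r mul0r addr0.
apply: ltr_wpDl; first by rewrite mulr_ge0 ?subr_ge0 // ltW.
by rewrite mulr_gt0 // lt_def t_neq0.
Qed.
End ZMatrix.

(** * Absolutely monotone functions *)

Lemma is_derive_mvt (R : realType) (g dg : R -> R) (a b : R) : a <= b ->
  (forall t, a <= t <= b -> is_derive t 1 g (dg t)) ->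
  exists2 c, a <= c <= b & g b - g a = dg c * (b - a).
Proof.
move=> ab g_der; have [||c] := @MVT_segment R g dg a b ab.
- by move=> t; rewrite in_itv /= => /andP[/ltW at_ /ltW tb]; apply: g_der; rewrite at_.
- apply: derivable_within_continuous => t; rewrite in_itv /= => /g_der gt.
  exact: ex_derive.
- by rewrite in_itv; exists c.
Qed.

Section Bernstein.
Variables (R : realType) (f : nat -> R -> R) (b : R).
Hypothesis f_der : forall k t, 0 <= t <= b -> is_derive t 1 (f k) (f k.+1 t).
Hypothesis f_ge0 : forall k t, 0 <= t <= b -> 0 <= f k t.

Let taylor N k t := \sum_(i < N) f (k + i)%N 0 / i`!%:R * t ^+ i.

(** The Taylor remainder of order [N] of [f k]; [drem N k] is its derivative. *)
Let rem N k t := f k t - taylor N k t.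

Let drem N k := if N is N'.+1 then rem N' k.+1 else f k.+1.

Let is_derive_rem N k t : 0 <= t <= b -> is_derive t 1 (rem N k) (drem N k t).
Proof.
move=> tb; case: N => [|N].
  rewrite (_ : rem 0 k = f k); first exact: f_der.
  by apply/funext => u; rewrite /rem /taylor big_ord0 subr0.
have T_der : is_derive t 1 (taylor N.+1 k) (taylor N k.+1 t).
  pose p : {poly R} := \poly_(i < N.+1) (f (k + i)%N 0 / i`!%:R).
  rewrite (_ : taylor N.+1 k = horner p); last first.
    by apply/funext => u; rewrite horner_poly.
  apply: (is_derive_eq (is_derive_poly p t)).
  have size_dp : (size (deriv p) <= N)%N.
    apply: leq_trans (size_poly _ _) _.
    by rewrite -subn1 leq_subLR add1n size_poly.
  rewrite (horner_coef_wide _ size_dp); apply: eq_bigr => i _; congr (_ * _).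
  rewrite coef_deriv coef_poly ltnS ltn_ord addSnnS factS natrM.
  rewrite -[LHS]mulr_natr invfM -!mulrA; congr (_ * _).
  by rewrite mulrCA mulVf ?mulr1 // pnatr_eq0.
exact: is_deriveB (f_der k tb) T_der.
Qed.

Let rem0 N k : rem N.+1 k 0 = 0.
Proof.
rewrite /rem /taylor big_ord_recl big1 => [|i _].
  by rewrite addn0 divr1 expr0 mulr1 addr0 subrr.
by rewrite lift0 expr0n mulr0.
Qed.

Let rem_ge0 N k t : 0 <= t <= b -> 0 <= rem N k t.
Proof.
elim: N k t => [|N IH] k t tb.
  by rewrite /rem /taylor big_ord0 subr0 f_ge0.
have [t0 t_b] := andP tb.
have t'b c : 0 <= c <= t -> 0 <= c <= b by case/andP=> -> ct; apply: le_trans ct t_b.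
have [c ct] := is_derive_mvt t0 (fun c ct => @is_derive_rem N.+1 k c (t'b c ct)).
by rewrite rem0 !subr0 => ->; rewrite mulr_ge0 // IH ?t'b.
Qed.

(** [t * drem N k t - N * rem N k t] vanishes at 0 and has the same shape,
    with [N - 1] and [k + 1], as its derivative; by induction it is
    nonnegative. *)
Let rem_growth N k t : 0 <= t <= b -> N%:R * rem N k t <= t * drem N k t.
Proof.
elim: N k t => [|N IH] k t tb; have [t0 t_b] := andP tb.
  by rewrite mul0r mulr_ge0 // f_ge0.
have t'b c : 0 <= c <= t -> 0 <= c <= b by case/andP=> -> ct; apply: le_trans ct t_b.
pose g u := u * rem N k.+1 u - N.+1%:R * rem N.+1 k u.
have g_der u : 0 <= u <= t -> is_derive u 1 g (u * drem N k.+1 u - N%:R * rem N k.+1 u).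
  move=> /t'b ub.
  have rN := is_derive_rem N k.+1 ub; have rN1 := is_derive_rem N.+1 k ub.
  apply: (is_derive_eq (is_deriveB (is_deriveM (is_derive_id u 1) rN) (is_deriveZ N.+1%:R rN1))).
  rewrite /GRing.scale /= -natr1 /=; ring.
have [c ct] := is_derive_mvt t0 g_der.
rewrite /g rem0 mul0r mulr0 !subr0 => eq_g.
by rewrite -subr_ge0 /= eq_g mulr_ge0 // subr_ge0 IH // t'b.
Qed.

(** By [rem_growth] the slope of the [N]-th remainder on [t, b] is at least
    [N / b] times its value at [t], while its total increase is at most [f 0 b].
    The remainder at [t] is therefore of order [1 / N]. *)
Lemma bernstein_taylor t : 0 <= t < b ->
  (fun N => \sum_(i < N) f i 0 / i`!%:R * t ^+ i) @ \oo --> f 0%N t.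
Proof.
move=> /andP[t0 t_b].
have b0 : 0 < b := le_lt_trans t0 t_b.
have bb : 0 <= b <= b by rewrite ltW /=.
have tb : 0 <= t <= b by rewrite t0 ltW.
have rem_le N : rem N.+1 0 t <= f 0 b * b / (b - t) * N.+1%:R^-1.
  have t'b c : t <= c <= b -> 0 <= c <= b.
    by case/andP=> tc ->; rewrite (le_trans t0 tc).
  have [c ct eq_c] := is_derive_mvt (ltW t_b)
    (fun c ct => @is_derive_rem N.+1 0 c (t'b c ct)).
  have [tc cb] := andP ct; have c0b := t'b c ct; have [c0 _] := andP c0b.
  have t''b u : t <= u <= c -> 0 <= u <= b.
    by case/andP=> tu uc; apply: t'b; rewrite tu (le_trans uc cb).
  have rem_tc : rem N.+1 0 t <= rem N.+1 0 c.
    have [u uc eq_u] := is_derive_mvt tc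
      (fun u uc => @is_derive_rem N.+1 0 u (t''b u uc)).
    rewrite -subr_ge0 eq_u; apply: mulr_ge0; last by rewrite subr_ge0.
    exact: (rem_ge0 N 1 (t''b u uc)).
  have rem_b : rem N.+1 0 b <= f 0 b.
    rewrite lerBlDr lerDl; apply: sumr_ge0 => i _.
    by rewrite mulr_ge0 ?divr_ge0 ?exprn_ge0 ?(ltW b0) ?f_ge0 ?lexx ?(ltW b0).
  have slope : N.+1%:R * rem N.+1 0 t <= b * drem N.+1 0 c.
    apply: (@le_trans _ _ (N.+1%:R * rem N.+1 0 c)); first by rewrite ler_pM2l.
    apply: le_trans (rem_growth N.+1 0 c0b) _.
    by rewrite ler_wpM2r //; exact: (rem_ge0 N 1 c0b).
  rewrite ler_pdivlMr // ler_pdivlMr ?subr_gt0 //.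
  have drop : drem N.+1 0 c * (b - t) <= f 0 b.
    by rewrite -eq_c; apply: le_trans rem_b; rewrite lerBlDr lerDl rem_ge0.
  apply: (@le_trans _ _ (b * drem N.+1 0 c * (b - t))).
    by rewrite ler_pM2r ?subr_gt0 // mulrC.
  by rewrite -mulrA mulrC ler_pM2r.
have taylorE : (fun N => \sum_(i < N) f i 0 / i`!%:R * t ^+ i) =
    (fun N => f 0%N t - rem N 0 t).
  by apply/funext => N; rewrite /rem opprB addrC subrK.
rewrite taylorE -[X in _ --> X]subr0; apply: cvgB; first exact: cvg_cst.
rewrite -(cvg_shiftS (fun N => rem N 0 t)) /=.
apply: (@squeeze_cvgr _ _ _ _ (cst 0) (fun N => f 0 b * b / (b - t) * N.+1%:R^-1)).
- by near=> N; rewrite rem_ge0 // rem_le.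
- exact: cvg_cst.
- rewrite -[X in _ --> X](mulr0 (f 0 b * b / (b - t))); apply: cvgMr; exact: cvg_harmonic.
Unshelve. all: by end_near. Qed.
End Bernstein.

(** * Differentiating an integral at a boundary point *)

Section IntegralDerivative.
Context d (T : measurableType d) (R : realType) (mu : measure T R).
Variables (f g : R -> T -> R) (F : R -> R) (dF : R).
Hypothesis f_meas : forall u : R, 0 <= u -> measurable_fun setT (f u).
Hypothesis g_meas : forall u : R, 0 <= u -> measurable_fun setT (g u).
Hypothesis f_ge0 : forall (u : R) (t : T), 0 <= u -> 0 <= f u t.
Hypothesis g_ge0 : forall (u : R) (t : T), 0 <= u -> 0 <= g u t.
Hypothesis f_der : forall (u : R) (t : T), 0 <= u -> is_derive u 1 (f^~ t) (- g u t).
Hypothesis g_noninc : forall (u v : R) (t : T), 0 <= u <= v -> g v t <= g u t.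
Hypothesis g_cont : forall t : T, {for (0 : R), continuous (g^~ t)}.
Hypothesis f_int : forall u : R, 0 <= u -> (\int[mu]_t (f u t)%:E = (F u)%:E)%E.
Hypothesis F_der : is_derive (0 : R) 1 F (- dF).

Let meas_E (h : T -> R) : measurable_fun setT h -> measurable_fun setT (EFin \o h).
Proof. by move=> mh; apply/measurable_EFinP. Qed.

Let mean_value u t : 0 < u ->
  f u t + u * g u t <= f 0 t /\ f 0 t <= f u t + u * g 0 t.
Proof.
move=> u0; have [c /andP[c0 cu] eq_c] := is_derive_mvt (ltW u0)
  (fun c (cu : 0 <= c <= u) => f_der t (proj1 (andP cu))).
have -> : f 0 t = f u t + u * g c t.
  by rewrite -[LHS](subKr (f u t)) eq_c subr0 mulNr opprK mulrC.
by rewrite !lerD2l !ler_pM2l // !g_noninc ?lexx ?c0 ?cu.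
Qed.

(** Integrating [mean_value] squeezes the difference quotient of [F] between the
    integrals of [g u] and of [g 0].  As [u] decreases to 0 the former increases
    to the latter by monotone convergence; the finiteness of the integral of
    [g 0] comes out of the argument. *)
Lemma integral_derivative : (\int[mu]_t (g 0 t)%:E = dF%:E)%E.
Proof.
pose h n : R := harmonic n.
have h_gt0 n : 0 < h n by rewrite /h /= invr_gt0.
have h_cvg : h n @[n --> \oo] --> 0 by exact: cvg_harmonic.
pose q n := (F 0 - F (h n)) / h n.
have q_cvg : (q n)%:E @[n --> \oo] --> dF%:E.
  apply: cvg_EFin; first by near=> n.
  have quot : h^-1 *: ((F \o shift 0) (h *: 1) - F 0) @[h --> 0^'] --> - dF.
    by rewrite -(@derive_val _ _ _ _ _ _ _ F_der); exact: ex_derive.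
  have := (proj1 (cvgr_dnbhsP _ _ _) quot) h (conj (fun n => lt0r_neq0 (h_gt0 n)) h_cvg).
  move=> /cvgN; rewrite opprK; apply: cvg_trans; apply: near_eq_cvg; near=> n.
  have shiftE : (F \o shift 0) ((h n)%:A : R) = F (h n).
    by congr F; rewrite /= addr0 [LHS]mulr1.
  rewrite -[LHS]/(- ((h n)^-1 * ((F \o shift 0) ((h n)%:A : R) - F 0))) shiftE.
  by rewrite -mulrN opprB mulrC.
have int_lin u v : 0 < u -> 0 <= v ->
    (\int[mu]_t (f u t + u * g v t)%:E = (F u)%:E + u%:E * \int[mu]_t (g v t)%:E)%E.
  move=> u0 v0; have u0' := ltW u0.
  under eq_integral do rewrite EFinD EFinM.
  rewrite ge0_integralD //=; last 4 first.
  - by move=> t _; rewrite lee_fin f_ge0.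
  - exact/meas_E/f_meas.
  - by move=> t _; rewrite mule_ge0 // lee_fin ?g_ge0.
  - by apply: measurable_funeM; exact/meas_E/g_meas.
  rewrite ge0_integralZl_EFin //; last 2 first.
  - by move=> t _; rewrite lee_fin g_ge0.
  - exact/meas_E/g_meas.
  by rewrite f_int.
have upper n : (\int[mu]_t (g (h n) t)%:E <= (q n)%:E)%E.
  have hn0 := ltW (h_gt0 n).
  rewrite [(q n)%:E]EFinM lee_pdivlMr // muleC -(@leeD2lE _ (F (h n))%:E) // -int_lin //.
  rewrite -EFinD addrC subrK -f_int //; apply: ge0_le_integral => //=.
  - by move=> t _; rewrite lee_fin addr_ge0 ?f_ge0 ?mulr_ge0 ?g_ge0.
  - by apply/measurable_EFinP; apply: measurable_funD; [exact: f_meas|apply: measurable_funM => //; exact: g_meas].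
  - exact/meas_E/f_meas.
  - by move=> t _; rewrite lee_fin; case: (mean_value t (h_gt0 n)).
have lower n : ((q n)%:E <= \int[mu]_t (g 0 t)%:E)%E.
  have hn0 := ltW (h_gt0 n).
  rewrite [(q n)%:E]EFinM lee_pdivrMr // muleC -(@leeD2lE _ (F (h n))%:E) // -int_lin //.
  rewrite -EFinD addrC subrK -f_int //; apply: ge0_le_integral => //=.
  - by move=> t _; rewrite lee_fin f_ge0.
  - exact/meas_E/f_meas.
  - by apply/measurable_EFinP; apply: measurable_funD; [exact: f_meas|apply: measurable_funM => //; exact: g_meas].
  - by move=> t _; rewrite lee_fin; case: (mean_value t (h_gt0 n)).
have g_cvg : (\int[mu]_t (g (h n) t)%:E)%E @[n --> \oo] --> (\int[mu]_t (g 0 t)%:E)%E.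
  have -> : (\int[mu]_t (g 0 t)%:E = \int[mu]_t limn (fun n => (g (h n) t)%:E))%E.
    apply: eq_integral => t _; apply/esym/cvg_lim => //.
    apply: cvg_EFin; first by near=> n.
    exact: (cvg_comp _ _ h_cvg (@g_cont t)).
  apply: cvg_monotone_convergence => //.
  - by move=> n; exact/meas_E/g_meas/ltW.
  - by move=> n t _; rewrite lee_fin g_ge0 // ltW.
  - move=> t _ m n mn; rewrite lee_fin g_noninc // ltW //=.
    by rewrite lef_pV2 ?posrE // ler_nat ltnS.
apply/eqP; rewrite eq_le; apply/andP; split.
  by apply: lee_cvg_to g_cvg q_cvg _; near=> n.
by apply: cvge_to_le q_cvg _; near=> n.
Unshelve. all: by end_near. Qed.
End IntegralDerivative.

(** * Moments from a completely monotone transform *)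

Lemma measurable_fun_bigprod d (T : measurableType d) (R : realType) (I : Type)
    (r : seq I) (Q : pred I) (h : I -> T -> R) :
  (forall i, measurable_fun setT (h i)) ->
  measurable_fun setT (fun t => \prod_(i <- r | Q i) h i t).
Proof.
move=> mh; elim: r => [|i r IH].
  by rewrite (_ : (fun _ => _) = cst 1) //; apply/funext => t; rewrite big_nil.
rewrite (_ : (fun _ => _) = fun t => (if Q i then h i t else 1) * \prod_(i <- r | Q i) h i t).
  by apply: measurable_funM => //; case: (Q i).
by apply/funext => t; rewrite big_cons; case: (Q i); rewrite ?mul1r.
Qed.

Section MomentRecursion.
Context d (T : measurableType d) (R : realType) (mu : measure T R).
Variables (n : nat) (alpha : R) (K : 'M[R]_n) (phi : 'I_n -> nat -> R -> T -> R).
Hypothesis phi_meas : forall j m (u : R), 0 <= u -> measurable_fun setT (phi j m u).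
Hypothesis phi_ge0 : forall j m (u : R) t, 0 <= u -> 0 <= phi j m u t.
Hypothesis phi_der : forall j m (u : R) t, 0 <= u ->
  is_derive u 1 (phi j m ^~ t) (- phi j m.+1 u t).
Hypothesis det_gt0 : forall s : 'rV[R]_n, (forall j, 0 <= s 0 j) -> 0 < \det (defect K s).
Hypothesis transform : forall s : 'rV[R]_n, (forall j, 0 <= s 0 j) ->
  (\int[mu]_t (\prod_j phi j 0%N (s 0 j) t)%:E = (\det (defect K s) `^ (- alpha))%:E)%E.

Let phi_noninc j m (u v : R) t : 0 <= u <= v -> phi j m v t <= phi j m u t.
Proof.
move=> /andP[u0 uv]; have c0 c : u <= c <= v -> 0 <= c by case/andP=> /(le_trans u0).
have [c /c0 cuv eq_c] := is_derive_mvt uv (fun c cuv => phi_der j m t (c0 c cuv)).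
by rewrite -subr_le0 eq_c mulr_le0_ge0 ?subr_ge0 // oppr_le0 phi_ge0.
Qed.

(** Each letter of [w] stands for one differentiation in the corresponding
    variable, applied to both members of the hypothesis [transform]. *)
Lemma integral_mixed_derivative (w : seq 'I_n) (s : 'rV[R]_n) :
  (forall j, 0 <= s 0 j) ->
  (\int[mu]_t (\prod_j phi j (count_mem j w) (s 0 j) t)%:E =
   ((-1) ^+ size w * genfun alpha K w s)%:E)%E.
Proof.
elim: w s => [|j w IH] s s_ge0.
  by rewrite /genfun word_permanent_nil !mul1r -transform.
pose P t := \prod_(i | i != j) phi i (count_mem i w) (s 0 i) t.
have P_meas : measurable_fun setT P by apply: measurable_fun_bigprod => i; exact: phi_meas.
have P_ge0 t : 0 <= P t by apply: prodr_ge0 => i _; exact: phi_ge0.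
pose c := count_mem j w; pose sj u : R := s 0 j + u.
have sj_ge0 u : 0 <= u -> 0 <= sj u by move=> u0; rewrite addr_ge0.
have sj_der (u : R) : is_derive u 1 sj 1.
  by apply: (is_derive_eq (is_deriveD (is_derive_cst (s 0 j) u 1) (is_derive_id u 1))); rewrite add0r.
have phi_sj_der m (u : R) t : 0 <= u ->
    is_derive u 1 (fun u => P t * phi j m (sj u) t) (- (P t * phi j m.+1 (sj u) t)).
  move=> /sj_ge0 /(phi_der j m t) phid.
  have comp := is_derive1_comp phid (sj_der u).
  apply: (is_derive_eq (is_deriveZ (P t) comp)).
  by rewrite mulr1 -mulrN.
pose su (u : R) := s + u *: delta_mx 0 j.
have su_ge0 u : 0 <= u -> forall i, 0 <= su u 0 i.
  by move=> u0 i; rewrite !mxE addr_ge0 // mulr_ge0 // ler0n.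
have prodE u t : \prod_i phi i (count_mem i w) (su u 0 i) t = P t * phi j c (sj u) t.
  rewrite (bigD1 j) //= mulrC !mxE !eqxx mulr1; congr (_ * _).
  apply: eq_bigr => i ij; rewrite !mxE (negbTE ij) andbF mulr0 addr0 //.
under eq_integral => t _.
  rewrite (bigD1 j) //= eqxx add1n mulrC (_ : \prod_(i | _) _ = P t); last first.
    by apply: eq_bigr => i; rewrite eq_sym => /negbTE ->; rewrite add0n.
  rewrite -[s 0 j]addr0 -/(sj 0) -/c.
  over.
apply: (@integral_derivative _ _ _ mu (fun u t => P t * phi j c (sj u) t)
  (fun u t => P t * phi j c.+1 (sj u) t) (fun u => (-1) ^+ size w * genfun alpha K w (su u))).
- by move=> u u0; apply: measurable_funM => //; exact/phi_meas/sj_ge0.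
- by move=> u u0; apply: measurable_funM => //; exact/phi_meas/sj_ge0.
- by move=> u t u0; rewrite mulr_ge0 // phi_ge0 // sj_ge0.
- by move=> u t u0; rewrite mulr_ge0 // phi_ge0 // sj_ge0.
- move=> u v t /andP[u0 uv]; rewrite ler_wpM2l // phi_noninc //.
  by rewrite sj_ge0 //= lerD2l.
- move=> t; apply/differentiable_continuous/derivable1_diffP.
  exact: (@ex_derive _ _ _ _ _ _ _ (phi_sj_der c.+1 0 t (lexx _))).
- move=> u u0; rewrite -(IH (su u)); last exact: su_ge0.
  by apply: eq_integral => t _; rewrite prodE.
- have s0 : su 0 = s by rewrite /su scale0r addr0.
  have D_gt0 : 0 < \det (defect K (su 0)) by rewrite s0 det_gt0.
  apply: (is_derive_eq (is_deriveZ ((-1) ^+ size w) (is_derive_genfun alpha w D_gt0))).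
  by rewrite -/(su 0) s0 /= exprS mulN1r mulNr opprK.
Qed.

Lemma moment_word_permanent (w : seq 'I_n) :
  (\int[mu]_t (\prod_j phi j (count_mem j w) 0 t)%:E =
   (word_permanent alpha (- K) w)%:E)%E.
Proof.
have /= := @integral_mixed_derivative w 0.
under eq_integral do under eq_bigr do rewrite mxE.
move=> ->; last by move=> j; rewrite mxE.
rewrite /genfun /resolvent /defect raddf0 mul0mx subr0 det1 powR1 mulr1.
by rewrite invmx1 mulmx1 word_permanentN.
Qed.

End MomentRecursion.

(** * From the law of Z to its generating function *)

Section GeneratingFunction.
Variables (R : realType) (n : nat) (alpha : R) (K : 'M[R]_n) (v : 'cV[R]_n).
Hypothesis alpha_ge0 : 0 <= alpha.
Hypothesis K_ge0 : forall i j, 0 <= K i j.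
Hypothesis v_gt0 : forall i, 0 < v i 0.

(** Positivity of [defect K x] on [v], written coordinatewise: this domain is a
    box, so each variable can be moved separately, and it is open on the right,
    which leaves room beyond the point where a Taylor series is summed. *)
Definition subcritical (x : 'rV[R]_n) :=
  forall i, 0 <= x 0 i /\ x 0 i * (K *m v) i 0 < v i 0.

Let Kv_ge0 i : 0 <= (K *m v) i 0.
Proof. by rewrite mxE sumr_ge0 // => j _; rewrite mulr_ge0 // ltW. Qed.

Let defect_Z x i j : subcritical x -> i != j -> defect K x i j <= 0.
Proof.
move=> /(_ i)[x_ge0 _] /negbTE ij.
by rewrite /defect mul_diag_mx !mxE ij sub0r oppr_le0 mulr_ge0.
Qed.

Let defect_v x i : subcritical x -> 0 < (defect K x *m v) i 0.
Proof.
move=> /(_ i)[_ xv]; rewrite mulmxBl mul1mx -mulmxA mul_diag_mx.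
by rewrite mxE [X in _ + X]mxE [X in _ - X]mxE subr_gt0.
Qed.

Lemma subcritical_det_gt0 x : subcritical x -> 0 < \det (defect K x).
Proof.
move=> xs; apply: Z_matrix_det_gt0 v_gt0 _ => [i j|i]; [exact: defect_Z|exact: defect_v].
Qed.

Lemma subcritical_genfun_ge0 w x : subcritical x -> 0 <= genfun alpha K w x.
Proof.
move=> xs; rewrite mulr_ge0 ?powR_ge0 //; apply: word_permanent_ge0 => // i j.
rewrite mxE sumr_ge0 // => k _; rewrite mulr_ge0 //.
apply: Z_matrix_inv_ge0 v_gt0 _ k j => [a b|a]; [exact: defect_Z|exact: defect_v].
Qed.

Lemma subcritical_taylor (w : seq 'I_n) (j : 'I_n) (y : 'rV[R]_n) (u : R) :
  0 <= u -> y 0 j = 0 -> subcritical (y + u *: delta_mx 0 j) ->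
  (fun N => \sum_(l < N) genfun alpha K (nseq l j ++ w) y / l`!%:R * u ^+ l) @ \oo -->
  genfun alpha K w (y + u *: delta_mx 0 j).
Proof.
move=> u0 yj ys; pose a := (K *m v) j 0.
have uE t i : (y + t *: delta_mx 0 j) 0 i = y 0 i + t * (i == j)%:R by rewrite !mxE.
have ua : u * a < v j 0 by have [_] := ys j; rewrite uE yj eqxx mulr1 add0r.
(* any [b > u] with [b * a < v j 0] would do; the [+ 1] covers [a = 0] *)
pose b := u + (v j 0 - u * a) / (a + 1).
have a1 : 0 < a + 1 by rewrite ltr_wpDl ?Kv_ge0.
have ub : u < b by rewrite ltrDl divr_gt0 // subr_gt0.
have ba : b * a < v j 0.
  rewrite mulrDl -ltrBrDl mulrAC ltr_pdivrMr // ltr_pM2l ?subr_gt0 //.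
  by rewrite ltrDl.
have sub t : 0 <= t <= b -> subcritical (y + t *: delta_mx 0 j).
  move=> /andP[t0 tb] i; have [] := ys i; rewrite !uE.
  have [->|_] := eqVneq i j; last by rewrite !mulr0.
  rewrite yj !mulr1 !add0r => _ _; split=> //.
  by apply: le_lt_trans ba; rewrite ler_wpM2r ?Kv_ge0.
have := @bernstein_taylor R (fun l t => genfun alpha K (nseq l j ++ w) (y + t *: delta_mx 0 j)) b _ _ u.
rewrite u0 ub /= scale0r addr0; apply=> // [l t tb|l t tb].
  exact/is_derive_genfun/subcritical_det_gt0/sub.
exact/subcritical_genfun_ge0/sub.
Qed.

Context d (T : measurableType d) (mu : measure T R).
Variables (N : 'I_n -> T -> nat) (c : R).
Hypothesis N_meas : forall i, measurable_fun setT (N i).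
Hypothesis N_law : forall k : 'I_n -> nat,
  (\int[mu]_t (\prod_i (N i t == k i)%:R)%:E =
   (c * word_permanent alpha K (block_word k (enum 'I_n)) / (\prod_i (k i)`!)%:R)%:E)%E.

Let restrict (x : 'rV[R]_n) (r : seq 'I_n) : 'rV[R]_n := \row_i (x 0 i *+ (i \in r)).

Let meas_N (h : nat -> R) i : measurable_fun setT (fun t => h (N i t)).
Proof. by apply: (measurableT_comp (f := h)). Qed.

(** The variables are summed over one at a time: for [i] in [r1] the value of
    [N i] has already been replaced by the power [x_i ^ N i], for [i] in [r2] it
    is still prescribed to be [k i].  Summing over the values of the next
    variable is a one-variable Taylor series. *)
Let partial_transform x (r1 r2 : seq 'I_n) (k : 'I_n -> nat) :
  subcritical x -> enum 'I_n = r1 ++ r2 ->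
  (\int[mu]_t (\prod_(i <- r1) x 0 i ^+ N i t * \prod_(i <- r2) (N i t == k i)%:R)%:E =
   (c * genfun alpha K (block_word k r2) (restrict x r1) /
     (\prod_(i <- r2) (k i)`!)%:R)%:E)%E.
Proof.
move=> xs; elim/last_ind: r1 r2 k => [|r1 j IH] r2 k enumE.
  have -> : restrict x [::] = 0 by apply/rowP => i; rewrite !mxE.
  rewrite /genfun /resolvent /defect raddf0 mul0mx subr0 det1 powR1 mulr1 invmx1 mulmx1.
  move: enumE; rewrite /= => <-; rewrite big_enum -N_law.
  by apply: eq_integral => t _; rewrite big_nil mul1r big_enum.
have uniq_r : uniq (rcons r1 j ++ r2) by rewrite -enumE enum_uniq.
have [j_r1 j_r2] : j \notin r1 /\ j \notin r2.
  move: uniq_r; rewrite cat_uniq rcons_uniq => /and3P[/andP[-> _] /hasPn r12 _].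
  split=> //; apply/negP => /r12; rewrite /= mem_rcons inE eqxx.
  by [].
pose k' l i := if i == j then l else k i.
have k'_r2 l i : i \in r2 -> k' l i = k i.
  by rewrite /k'; case: eqVneq => // -> ir; rewrite ir in j_r2.
rewrite cat_rcons in enumE.
pose a l t := x 0 j ^+ l * (\prod_(i <- r1) x 0 i ^+ N i t *
  \prod_(i <- j :: r2) (N i t == k' l i)%:R).
have a_ge0 l t : 0 <= a l t.
  rewrite !mulr_ge0 ?exprn_ge0 ?(proj1 (xs j)) //; apply: prodr_ge0 => i _ //.
  by rewrite exprn_ge0 // (proj1 (xs i)).
have pow_meas : measurable_fun setT (fun t => \prod_(i <- r1) x 0 i ^+ N i t).
  by apply: measurable_fun_bigprod => i; exact: (meas_N (fun m => x 0 i ^+ m)).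
have ind_meas l : measurable_fun setT (fun t => \prod_(i <- j :: r2) (N i t == k' l i)%:R : R).
  by apply: measurable_fun_bigprod => i; exact: (meas_N (fun m => (m == k' l i)%:R)).
have a_meas l : measurable_fun setT (a l).
  by apply: measurable_funM => //; apply: measurable_funM.
have sum_a t : (\prod_(i <- rcons r1 j) x 0 i ^+ N i t * \prod_(i <- r2) (N i t == k i)%:R)%:E =
    (\sum_(0 <= l <oo) (a l t)%:E)%E.
  apply/esym/lim_near_cst => //; exists (N j t).+1 => // m /= Nm.
  rewrite sumEFin; congr EFin; rewrite (bigD1_seq (N j t)) ?mem_index_iota ?iota_uniq //=.
  rewrite big1 ?addr0 => [|l lN]; last first.
    by rewrite /a big_cons /k' eqxx eq_sym (negbTE lN) mul0r !mulr0.
  rewrite /a big_cons /k' !eqxx mul1r big_rcons /= mulrA; congr (_ * _).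
    by rewrite mulrC.
  by apply: eq_big_seq => i ir; rewrite -/(k' (N j t) i) k'_r2.
under eq_integral do rewrite sum_a.
rewrite integral_nneseries //; last 2 first.
- by move=> l; apply/measurable_EFinP.
- by move=> l t _; rewrite lee_fin.
pose w := block_word k r2; pose y := restrict x r1.
have int_a l : (\int[mu]_t (a l t)%:E = (c / (\prod_(i <- r2) (k i)`!)%:R *
    (genfun alpha K (nseq l j ++ w) y / l`!%:R * x 0 j ^+ l))%:E)%E.
  under eq_integral do rewrite /a EFinM.
  rewrite ge0_integralZl_EFin ?exprn_ge0 ?(proj1 (xs j)) //; last 2 first.
  - move=> t _; rewrite lee_fin mulr_ge0 // prodr_ge0 // => i _.
    by rewrite exprn_ge0 // (proj1 (xs i)).
  - apply/measurable_EFinP; exact: measurable_funM.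
  rewrite IH // -EFinM; congr EFin.
  have -> : block_word (k' l) (j :: r2) = nseq l j ++ w.
    rewrite /w /block_word /= {1}/k' eqxx; congr (_ ++ flatten _).
    by apply/eq_in_map => i ir; rewrite k'_r2.
  rewrite big_cons /k' eqxx (eq_big_seq (fun i => (k i)`!)); last first.
    by move=> i ir; rewrite -/(k' l i) k'_r2.
  rewrite natrM invfM -/y.
  move: (genfun _ _ _ _) (_ ^+ _) (_`!%:R^-1) (_%:R^-1) => g1 g2 g3 g4; ring.
have yj : y 0 j = 0 by rewrite mxE (negbTE j_r1).
have yE : y + x 0 j *: delta_mx 0 j = restrict x (rcons r1 j).
  apply/rowP => i; rewrite !mxE mem_rcons inE.
  have [->|ij] := eqVneq i j; first by rewrite (negbTE j_r1) add0r mulr1.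
  by rewrite mulr0 addr0.
have ys : subcritical (y + x 0 j *: delta_mx 0 j).
  move=> i; have [x0 xv] := xs i; rewrite yE mxE.
  by case: (i \in _); rewrite ?mulr1n ?mulr0n ?mul0r.
have lim_w := @subcritical_taylor w j y (x 0 j) (proj1 (xs j)) yj ys.
rewrite -yE; apply/cvg_lim => //.
apply: cvg_EFin; first by apply: nearW => m; under eq_bigr do rewrite int_a; rewrite sumEFin.
have lim_c : (fun m => c / (\prod_(i <- r2) (k i)`!)%:R *
    \sum_(l < m) genfun alpha K (nseq l j ++ w) y / l`!%:R * x 0 j ^+ l) @ \oo -->
    c / (\prod_(i <- r2) (k i)`!)%:R * genfun alpha K w (y + x 0 j *: delta_mx 0 j).
  by apply: cvgMr; exact: lim_w.
rewrite mulrAC; apply: cvg_trans lim_c; apply: near_eq_cvg; apply: nearW => m /=.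
under [in RHS]eq_bigr do rewrite int_a.
by rewrite sumEFin /= big_mkord mulr_sumr.
Qed.

(** The multivariate identity
    sum_k |K(k)|_alpha x^k / k! = |I - X K|^(-alpha), in probabilistic form. *)
Lemma transform_of_law x : subcritical x ->
  (\int[mu]_t (\prod_i x 0 i ^+ N i t)%:E = (c * \det (defect K x) `^ (- alpha))%:E)%E.
Proof.
move=> xs; have := @partial_transform x (enum 'I_n) [::] (fun=> 0%N) xs (esym (cats0 _)).
rewrite !big_nil divr1 /genfun word_permanent_nil mul1r.
have -> : restrict x (enum 'I_n) = x by apply/rowP => i; rewrite mxE mem_enum.
by move=> <-; apply: eq_integral => t _; rewrite big_nil mulr1 big_enum.
Qed.

End GeneratingFunction.

(** * Nonsingular M-matrices *)

Section MMatrix.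
Variables (R : realType) (n : nat) (A : 'M[R]_n).
Hypothesis A_M : nonsingular_M_matrix A.

Lemma M_matrix_diag_gt0 i : 0 < A i i.
Proof.
case: A_M => off uA inv0.
have := congr1 (fun M : 'M[R]_n => M i i) (mulmxV uA).
rewrite !mxE eqxx (bigD1 i) //= => sum1.
have : 0 < A i i * invmx A i i.
  apply: lt_le_trans ltr01 _; rewrite -[leLHS]sum1 gerDl.
  by apply: sumr_le0 => k ki; rewrite mulr_le0_ge0 // off // eq_sym.
have := inv0 i i; rewrite le0r => /orP[/eqP ->|iv]; first by rewrite mulr0 ltxx.
by rewrite pmulr_lgt0.
Qed.

Let dinv : 'rV[R]_n := \row_i (A i i)^-1.

Let diag_dinv : diag_part A *m diag_mx dinv = 1%:M.
Proof.
rewrite /diag_part mul_diag_mx; apply/matrixP => i j; rewrite !mxE.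
have [->|_] := eqVneq i j; last by rewrite mulr0n mulr0.
by rewrite mulfV // gt_eqF // M_matrix_diag_gt0.
Qed.

Lemma diag_part_unit : diag_part A \in unitmx.
Proof. by have [] := mulmx1_unit diag_dinv. Qed.

Let invmx_diag : invmx (diag_part A) = diag_mx dinv.
Proof. by rewrite -[LHS]mulmx1 -diag_dinv mulKmx ?diag_part_unit. Qed.

Lemma Abar_unit : Abar A \in unitmx.
Proof. by case: A_M => _ uA _; rewrite unitmx_mul unitmx_inv diag_part_unit. Qed.

Lemma Bbar_Abar : Bbar A = 1%:M - Abar A.
Proof. by rewrite /Bbar /off_part mulmxBr mulVmx ?diag_part_unit. Qed.

Lemma RbarE : Rbar A = invmx A *m diag_part A.
Proof.
case: A_M => _ uA _.
have inv : Abar A *m (invmx A *m diag_part A) = 1%:M.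
  by rewrite /Abar -mulmxA mulKVmx // mulVmx // diag_part_unit.
by rewrite -[RHS](mulKmx Abar_unit) inv mulmx1.
Qed.

Lemma Bbar_ge0 i j : 0 <= Bbar A i j.
Proof.
case: A_M => off _ _; rewrite /Bbar invmx_diag mul_diag_mx mxE mulr_ge0 //.
  by rewrite mxE invr_ge0 ltW // M_matrix_diag_gt0.
rewrite !mxE; have [->|ij] := eqVneq i j; first by rewrite mulr1n subrr.
by rewrite mulr0n sub0r oppr_ge0 off.
Qed.

(** [v] solves [Abar A *m v = 1], so that [v = 1 + Bbar A *m v] exceeds
    [Bbar A *m v] in every coordinate. *)
Let v : 'cV[R]_n := Rbar A *m const_mx 1.

Lemma Rbar_sum_ge0 i : 0 <= v i 0.
Proof.
case: A_M => off _ inv0; rewrite mxE sumr_ge0 // => j _; rewrite [X in _ * X]mxE mulr1.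
rewrite RbarE /diag_part mul_mx_diag mxE mulr_ge0 // mxE ltW //.
exact: M_matrix_diag_gt0.
Qed.

Let v_eq : v = const_mx 1 + Bbar A *m v.
Proof.
by rewrite Bbar_Abar mulmxBl mul1mx /v mulmxA mulmxV ?Abar_unit // mul1mx addrC subrK.
Qed.

Let v_gt i : (Bbar A *m v) i 0 < v i 0.
Proof. by rewrite [ltRHS](congr1 (fun u : 'cV[R]_n => u i 0) v_eq) !mxE ltrDr ltr01. Qed.

Lemma Rbar_sum_gt0 i : 0 < v i 0.
Proof.
apply: le_lt_trans (v_gt i); rewrite mxE sumr_ge0 // => j _.
by rewrite mulr_ge0 ?Bbar_ge0 // Rbar_sum_ge0.
Qed.

Lemma unit_box_subcritical (x : 'rV[R]_n) : (forall i, 0 <= x 0 i <= 1) -> subcritical (Bbar A) v x.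
Proof.
move=> x01 i; have /andP[x0 x1] := x01 i; split=> //; apply: le_lt_trans (v_gt i).
rewrite ler_piMl // mxE sumr_ge0 // => j _.
by rewrite mulr_ge0 ?Bbar_ge0 // Rbar_sum_ge0.
Qed.

Lemma det_defect_Bbar_gt0 (x : 'rV[R]_n) : (forall i, 0 <= x 0 i <= 1) -> 0 < \det (defect (Bbar A) x).
Proof.
move=> /unit_box_subcritical; apply: subcritical_det_gt0; [exact: Bbar_ge0|exact: Rbar_sum_gt0].
Qed.

Lemma det_Abar_gt0 : 0 < \det (Abar A).
Proof.
have := @det_defect_Bbar_gt0 (const_mx 1) _.
rewrite /defect diag_const_mx mul1mx Bbar_Abar opprB addrC subrK; apply=> i.
by rewrite mxE ler01 lexx.
Qed.

Lemma defect_Rbar_Abar (s : 'rV[R]_n) :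
  defect (- Rbar A) s *m Abar A = Abar A + diag_mx s.
Proof.
rewrite /defect mulmxN opprK mulmxDl mul1mx -mulmxA.
by rewrite mulVmx ?Abar_unit // mulmx1.
Qed.

(** Both sides are the determinant of [Abar A + diag_mx s], since
    (1 + S)(1 - (1 + S)^(-1) Bbar) = 1 + S - Bbar. *)
Lemma det_defect_Rbar (s : 'rV[R]_n) : (forall j, 0 <= s 0 j) ->
  \det (defect (- Rbar A) s) * \det (Abar A) =
  \prod_j (1 + s 0 j) * \det (defect (Bbar A) (\row_j (1 + s 0 j)^-1)).
Proof.
move=> s0; rewrite -det_mulmx defect_Rbar_Abar.
rewrite (_ : \prod_j _ = \det (diag_mx (\row_j (1 + s 0 j)))); last first.
  by rewrite det_diag; apply: eq_bigr => j _; rewrite mxE.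
rewrite -det_mulmx; congr determinant.
apply/matrixP => i j; rewrite mul_diag_mx /defect mul_diag_mx Bbar_Abar !mxE.
have s1 : 1 + s 0 i != 0 by rewrite gt_eqF // ltr_pwDl.
rewrite mulrBr mulrA mulfV // mul1r opprB.
case: eqVneq => [->|_]; rewrite ?mulr1n ?mulr0n; ring.
Qed.

Lemma det_defect_Rbar_gt0 (s : 'rV[R]_n) : (forall j, 0 <= s 0 j) ->
  0 < \det (defect (- Rbar A) s).
Proof.
move=> s0; rewrite -(pmulr_lgt0 _ det_Abar_gt0) det_defect_Rbar // mulr_gt0 //.
  by apply: prodr_gt0 => j _; rewrite ltr_pwDl.
apply: det_defect_Bbar_gt0 => j; rewrite mxE invr_ge0 invf_le1 ?ltr_pwDl //.
by rewrite addr_ge0 //= lerDl s0.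
Qed.

Lemma det_defect_Rbar_Laplace (s : 'rV[R]_n) :
  \det (1%:M + invmx A *m diag_mx (\row_j (s 0 j * A j j))) =
  \det (defect (- Rbar A) s).
Proof.
have eqs : diag_mx (\row_j (s 0 j * A j j)) = diag_part A *m diag_mx s.
  rewrite /diag_part mul_diag_mx; apply/matrixP => i j; rewrite !mxE.
  by case: eqVneq => _; rewrite ?mulr1n ?mulr0n ?mulr0 // mulrC.
apply: (mulfI (lt0r_neq0 det_Abar_gt0)).
rewrite [RHS]mulrC -!det_mulmx defect_Rbar_Abar eqs mulmxA -RbarE.
by rewrite mulmxDr mulmx1 mulmxA mulmxV ?Abar_unit // mul1mx.
Qed.

End MMatrix.

(** * The two random vectors *)

Section Laplace.
Context d (T : measurableType d) (R : realType) (P : probability T R).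
Variables (n : nat) (alpha : R) (A : 'M[R]_n) (X : {RV P >-> n.-tuple R}).
Hypothesis A_M : nonsingular_M_matrix A.
Hypothesis X_perm : permanental alpha (invmx A) X.

Let Y j t : R := `|A j j * tnth (X t) j|.

Let aX_meas j : measurable_fun setT (fun t => A j j * tnth (X t) j).
Proof.
apply: measurable_funM => //; apply: (measurableT_comp (measurable_tnth j)).
exact: measurable_funPT.
Qed.

Let Y_meas j : measurable_fun setT (Y j).
Proof. exact: (measurableT_comp (@normr_measurable R setT)). Qed.

(** The components of X are nonnegative only almost surely; [Y] is a version of
    a X that is nonnegative everywhere. *)
Let Y_ae (h : 'I_n -> R -> R) : (forall j, measurable_fun setT (h j)) ->
  (\int[P]_t (\prod_j h j (A j j * tnth (X t) j))%:E = \int[P]_t (\prod_j h j (Y j t))%:E)%E.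
Proof.
move=> h_meas; apply: ae_eq_integral => //.
- apply/measurable_EFinP; apply: measurable_fun_bigprod => j.
  exact: (measurableT_comp (h_meas j)).
- apply/measurable_EFinP; apply: measurable_fun_bigprod => j.
  exact: (measurableT_comp (h_meas j)).
case: X_perm => X_ge0 _; apply: filterS X_ge0 => t Xt _.
congr EFin; apply: eq_bigr => j _; rewrite /Y ger0_norm // mulr_ge0 //.
by rewrite ltW // M_matrix_diag_gt0.
Qed.

Let phi (j : 'I_n) (m : nat) (u : R) (t : T) : R := Y j t ^+ m * expR (- (u * Y j t)).

Lemma permanental_moments (w : seq 'I_n) :
  (\int[P]_t (\prod_j (A j j * tnth (X t) j) ^+ count_mem j w)%:E =
   (word_permanent alpha (Rbar A) w)%:E)%E.
Proof.
rewrite (Y_ae (h := fun j y => y ^+ count_mem j w)); last first.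
  by move=> j; exact: measurable_funX.
transitivity (\int[P]_t (\prod_j phi j (count_mem j w) 0 t)%:E)%E.
  apply: eq_integral => t _; congr EFin; apply: eq_bigr => j _.
  by rewrite /phi mul0r oppr0 expR0 mulr1.
rewrite -[in RHS](opprK (Rbar A)).
apply: (@moment_word_permanent _ T R P n alpha (- Rbar A) phi).
- move=> j m u _; apply: measurable_funM; first exact: measurable_funX.
  apply: (measurableT_comp (@measurable_expR R)).
  by apply: measurable_funN; exact: measurable_funM.
- by move=> j m u t _; rewrite mulr_ge0 ?exprn_ge0 ?expR_ge0 ?normr_ge0.
- move=> j m u t _; pose g (z : R) := - (z * Y j t).
  have g_der : is_derive u 1 g (- Y j t).
    rewrite (_ : g = (- Y j t) \*: (id : R -> R)).
      apply: (is_derive_eq (is_deriveZ _ (is_derive_id u 1))); exact: mulr1.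
    by apply/funext => z; rewrite /g /= [RHS]mulNr mulrC.
  apply: (is_derive_eq (is_deriveZ (Y j t ^+ m) (is_derive1_comp (is_derive_expR (g u)) g_der))).
  by rewrite /phi -/(g u) /GRing.scale /= exprS mulrN mulrN; congr (- _); ring.
- by move=> s s0; exact: det_defect_Rbar_gt0.
- move=> s s0; rewrite -(det_defect_Rbar_Laplace A_M).
  case: X_perm => _ /(_ (\row_j (s 0 j * A j j))) <-; last first.
    by move=> j; rewrite mxE mulr_ge0 // ltW // M_matrix_diag_gt0.
  under eq_integral do under eq_bigr do rewrite /phi expr0 mul1r.
  rewrite -(Y_ae (h := fun j y => expR (- (s 0 j * y)))) => [|j]; last first.
    apply: (measurableT_comp (@measurable_expR R)).
    by apply: measurable_funN; exact: measurable_funM.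
  rewrite expectation.unlock; apply: eq_integral => t _; rewrite -expR_sum; congr (expR _)%:E.
  by rewrite -sumrN; apply: eq_bigr => j _; rewrite mxE mulrA.
Qed.

End Laplace.

Section NegativeBinomialMixture.
Context d (T : measurableType d) (R : realType) (P : probability T R).
Variables (n : nat) (alpha : R) (A : 'M[R]_n) (Z : {RV P >-> n.-tuple nat}).
Hypothesis alpha_gt0 : 0 < alpha.
Hypothesis A_M : nonsingular_M_matrix A.
Hypothesis Z_dist : Z_distributed alpha A Z.

Let N j t := tnth (Z t) j.

Let N_meas j : measurable_fun setT (N j).
Proof. apply: (measurableT_comp (measurable_tnth j)); exact: measurable_funPT. Qed.

Let meas_N (h : nat -> R) j : measurable_fun setT (fun t => h (N j t)).
Proof. by apply: (measurableT_comp (f := h)). Qed.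

(** The product of the indicators of [N i t = k i] is the indicator of the event
    that [Z] equals the tuple of the [k i]. *)
Let N_law (k : 'I_n -> nat) :
  (\int[P]_t (\prod_i (N i t == k i)%:R)%:E =
   (\det (Abar A) `^ alpha * word_permanent alpha (Bbar A) (block_word k (enum 'I_n)) /
     (\prod_i (k i)`!)%:R)%:E)%E.
Proof.
pose kt := [tuple k i | i < n].
have ktE : tnth kt = k by apply/funext => i; rewrite tnth_mktuple.
have indE t : \prod_i (N i t == k i)%:R = \1_(Z @^-1` [set kt]) t :> R.
  rewrite indicE; have [Zk|Zk] := boolP (Z t == kt).
    rewrite mem_set ?big1 //=; last exact/eqP.
    by move=> i _; rewrite /N (eqP Zk) ktE eqxx.
  rewrite memNset /=; last exact/eqP.
  have [i Ni] : exists i, N i t != k i.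
    apply/existsP; rewrite -negb_forall; apply: contra Zk => /forallP Nk.
    by apply/eqP/eq_from_tnth => i; rewrite ktE; apply/eqP/Nk.
  by rewrite (bigD1 i) //= (negbTE Ni) mul0r.
have Z_meas : measurable (Z @^-1` [set kt]).
  have h_meas : measurable_fun setT (fun t => \prod_i (N i t == k i)%:R : R).
    by apply: measurable_fun_bigprod => i; exact: (meas_N (fun m => (m == k i)%:R)).
  have := h_meas measurableT [set 1] (measurable_set1 1).
  rewrite setTI; congr measurable; apply/seteqP; split=> t /=; rewrite indE indicE.
    by case: (boolP (t \in _)) => [/set_mem //|_ /eqP]; rewrite eq_sym oner_eq0.
  by move=> Zt; rewrite mem_set.
under eq_integral do rewrite indE.
rewrite integral_indic // setIT.
by rewrite -[LHS]/(P (Z @^-1` [set kt])) Z_dist alpha_permanent_blowup ktE mulrA.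
Qed.

Let phi (j : 'I_n) (m : nat) (u : R) (t : T) : R :=
  \prod_(0 <= l < m) (alpha + (N j t)%:R + l%:R) *
  (1 + u) `^ (- (alpha + (N j t)%:R + m%:R)).

Lemma rising_factorial_moments (w : seq 'I_n) :
  (\int[P]_t (\prod_j \prod_(0 <= l < count_mem j w) (alpha + (N j t)%:R + l%:R))%:E =
   (word_permanent alpha (Rbar A) w)%:E)%E.
Proof.
transitivity (\int[P]_t (\prod_j phi j (count_mem j w) 0 t)%:E)%E.
  apply: eq_integral => t _; congr EFin; apply: eq_bigr => j _.
  by rewrite /phi addr0 powR1 mulr1.
rewrite -[in RHS](opprK (Rbar A)).
apply: (@moment_word_permanent _ T R P n alpha (- Rbar A) phi).
- move=> j m u _; exact: (meas_N (fun N => \prod_(0 <= l < m) (alpha + N%:R + l%:R) *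
    (1 + u) `^ (- (alpha + N%:R + m%:R)))).
- move=> j m u t _; rewrite mulr_ge0 ?powR_ge0 // prodr_ge0 // => l _.
  by rewrite !addr_ge0 // ltW.
- move=> j m u t u0; pose b := alpha + (N j t)%:R + m%:R.
  have u1 : 0 < 1 + u by rewrite ltr_pwDl.
  have shift_der : is_derive u 1 (fun z : R => 1 + z) 1.
    by apply: (is_derive_eq (is_deriveD (is_derive_cst (1 : R) u 1) (is_derive_id u 1))); rewrite add0r.
  apply: (is_derive_eq (is_deriveZ (\prod_(0 <= l < m) (alpha + (N j t)%:R + l%:R))
    (is_derive1_comp (is_derive1_powR (- b) u1) shift_der))).
  rewrite /phi -/b big_nat_recr //= -natr1 addrA -/b (opprD b 1) mulr1.
  by rewrite /GRing.scale /= mulrA mulrN !mulNr.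
- by move=> s s0; exact: det_defect_Rbar_gt0.
move=> s s0; (* at this point the generating function of [Z] becomes the transform *)
pose x : 'rV[R]_n := \row_j (1 + s 0 j)^-1.
have s1 j : 0 < 1 + s 0 j by rewrite ltr_pwDl.
have x01 j : 0 <= x 0 j <= 1.
  by rewrite mxE invr_ge0 invf_le1 // ltW //= lerDl s0.
have powR_prod (f : 'I_n -> R) : (forall j, 0 < f j) ->
    \prod_j f j `^ (- alpha) = (\prod_j f j) `^ (- alpha).
  move=> f_gt0; suff [] : 0 < \prod_j f j /\
      \prod_j f j `^ (- alpha) = (\prod_j f j) `^ (- alpha) by [].
  apply: (big_rec2 (fun a b => 0 < b /\ a = b `^ (- alpha))) => [|j a b _ [b0 ->]].
    by rewrite powR1.
  by rewrite mulr_gt0 ?powRM ?(ltW (f_gt0 j)) ?(ltW b0).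
pose p := \prod_j (1 + s 0 j).
transitivity (\int[P]_t (p `^ (- alpha) * \prod_j x 0 j ^+ N j t)%:E)%E.
  apply: eq_integral => t _; congr EFin; rewrite -powR_prod // -big_split /=.
  apply: eq_bigr => j _; rewrite /phi big_geq // mul1r addr0 mxE opprD powRD.
    by rewrite [X in _ * X]powRN powR_mulrn ?exprVn // ltW.
  by rewrite (gt_eqF (s1 j)) implybT.
under eq_integral do rewrite EFinM.
rewrite ge0_integralZl_EFin ?powR_ge0 //; last 2 first.
- move=> t _; rewrite lee_fin prodr_ge0 // => j _; rewrite exprn_ge0 //.
  by case/andP: (x01 j).
- apply/measurable_EFinP; apply: measurable_fun_bigprod => j.
  exact: (meas_N (fun m => x 0 j ^+ m)).
rewrite (transform_of_law (ltW alpha_gt0) (Bbar_ge0 A_M) (Rbar_sum_gt0 A_M) N_meas N_law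
  (unit_box_subcritical A_M x01)).
rewrite -EFinM; congr EFin.
have detA := det_Abar_gt0 A_M.
have dx := det_defect_Bbar_gt0 A_M x01.
have ds := det_defect_Rbar_gt0 A_M s0.
apply: (mulIf (lt0r_neq0 (powR_gt0 (- alpha) detA))).
rewrite -(powRM _ (ltW ds) (ltW detA)) det_defect_Rbar // powRM ?(ltW dx) ?prodr_ge0 //; last first.
  by move=> j _; exact: ltW.
rewrite -/p -/x (mulrC (\det _ `^ alpha)) -!mulrA -powRD.
  by rewrite subrr powRr0 mulr1.
by rewrite (gt_eqF detA) implybT.
Qed.
End NegativeBinomialMixture.

Theorem lemma1p4 (R : realType) (n : nat) (alpha : R) (A : 'M[R]_n)
    (d' : measure_display) (T' : measurableType d') (P' : probability T' R)
    (Z : {RV P' >-> n.-tuple nat}) (m : n.-tuple nat) :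
  0 < alpha ->
  nonsingular_M_matrix A ->
  Z_distributed alpha A Z ->
  (forall j : 'I_n, (1 <= tnth m j)%N) ->
  (forall (d : measure_display) (T : measurableType d) (P : probability T R)
      (X : {RV P >-> n.-tuple R}),
    permanental alpha (invmx A) X ->
    'E_P[(fun t => \prod_(j < n) (A j j * tnth (X t) j) ^+ tnth m j)%R]%E =
    'E_P'[(fun t => \prod_(j < n) \prod_(0 <= l < tnth m j)
                     (alpha + (tnth (Z t) j)%:R + l%:R))%R]%E) /\
  (alpha_permanent alpha (blowup (Rbar A) m))%:E =
    'E_P'[(fun t => \prod_(j < n) \prod_(0 <= l < tnth m j)
                     (alpha + (tnth (Z t) j)%:R + l%:R))%R]%E.
Proof.
move=> alpha_gt0 A_M Z_dist _; pose w := block_word (tnth m) (enum 'I_n).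
have count_w j : count_mem j w = tnth m j.
  by rewrite count_block_word count_uniq_mem ?enum_uniq // mem_enum muln1.
have Z_moments : 'E_P'[(fun t => \prod_(j < n) \prod_(0 <= l < tnth m j)
    (alpha + (tnth (Z t) j)%:R + l%:R))%R]%E = (word_permanent alpha (Rbar A) w)%:E.
  rewrite expectation.unlock -(rising_factorial_moments alpha_gt0 A_M Z_dist).
  by apply: eq_integral => t _; under [in RHS]eq_bigr do rewrite count_w.
rewrite Z_moments alpha_permanent_blowup; split=> // d T P X X_perm.
rewrite expectation.unlock -(permanental_moments A_M X_perm).
by apply: eq_integral => t _; under [in RHS]eq_bigr do rewrite count_w.
Qed.
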